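(* Let $\Omega$ be a polyhedral domain of $\mathbb{R}^n$ and let $\Phi\in\mathrm{Diff}_0(\overline{\Omega})$. Then $\Phi=\mathrm{id}+\varphi$ with $\varphi\in\mathcal{U}_0(\Omega)$.
   Context: $\mathrm{id}$ is the identity map. Simplex: a closed subset $\sigma\subset\mathbb{R}^n$ is a $k$-simplex if it is the convex hull of a finite set $\{x_1,\dots,x_{k+1}\}$ and is not contained in a $(k-1)$-dimensional affine subspace. For any non-empty $I\subset\{x_1,\dots,x_{k+1}\}$ the convex hull of $I$ is called a face of $\sigma$. Polyhedron: $K\subset\mathbb{R}^n$ is a bounded polyhedron if there is a finite set of $n$-simplices $\sigma_1,\dots,\sigma_\ell$ of $\mathbb{R}^n$ whose union is $K$ and such that for any $1\le i<j\le\ell$ the set $\sigma_i\cap\sigma_j$ is either empty or an entire face of both of them. Polyhedral domain: an open set $\Omega\subset\mathbb{R}^n$ is a (bounded) polyhedral domain if $\Omega$ is a connected Lipschitz domain of $\mathbb{R}^n$ and $\overline{\Omega}$ is a bounded polyhedron. $\mathcal{U}_0(\Omega)=\{\varphi\in C^1(\overline{\Omega};\mathbb{R}^n):\varphi\cdot\mathbf{n}|_{\partial\Omega}=0\}$, where $\mathbf{n}$ is the outward unit normal (defined almost everywhere on $\partial\Omega$) and the boundary condition is understood almost everywhere on $\partial\Omega$. $\mathrm{Diff}(\overline{\Omega})$ is the set of diffeomorphisms of $\overline{\Omega}$: a function $\Phi:\overline{\Omega}\to\mathbb{R}^n$ belongs to $\mathrm{Diff}(\overline{\Omega})$ if it is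 of class $C^1$ up to the boundary and is bijective (one-to-one and onto) in $\overline{\Omega}$. $\mathrm{Diff}_0(\overline{\Omega})$ is the subset of diffeomorphisms $\Phi$ that are isotopic to the identity: there exists a smooth field (isotopy) $X:\overline{\Omega}\times[0,1]\to\mathbb{R}^n$ such that (i) $X(\cdot,0)=\mathrm{id}$; (ii) $X(\cdot,1)=\Phi$; (iii) $X(\cdot,t)\in\mathrm{Diff}(\overline{\Omega})$ for all $t\in[0,1]$; (iv) $\partial_tX(\cdot,t)\in C^1(\overline{\Omega})$ for all $t\in[0,1]$.
   Formalization: Diffeomorphisms in Diff are also required to have an inverse of class C^1 up to the boundary; for mere C^1 bijections the claim fails (on a square, an isotopy through C^1 bijections with critical points at corners can rotate the edges). *)

(* Defs.v *)
From HB Require Import structures.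
From mathcomp Require Import all_boot all_order all_algebra.
From mathcomp Require Import all_classical all_reals all_analysis.

Set Implicit Arguments.
Unset Strict Implicit.
Unset Printing Implicit Defensive.

Import Order.TTheory GRing.Theory Num.Theory.
Import numFieldNormedType.Exports.

Local Open Scope classical_set_scope.
Local Open Scope ring_scope.

Section Euclidean.
Context {R : realType} {n : nat}.
Implicit Types (x y : 'rV[R]_n) (A : set 'rV[R]_n).

(* The norm of 'rV[R]_n in the library is the max norm; it is only used below
   for topology, differentiability and Lipschitz continuity, none of which
   depend on the choice of a norm. *)
Definition edot x y : R := \sum_(i < n) x 0 i * y 0 i.

Definition enorm x : R := Num.sqrt (edot x x).

Definition boundary A : set 'rV[R]_n := closure A `\` A°.

(* The supremum of the empty set is -oo, hence the separate case of set0 in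
   ediam_pow; since x ^+ 0 = 1, the measure hausdorff 0 is the counting
   measure. *)
Definition ediam A : \bar R :=
  ereal_sup [set (enorm (z.1 - z.2))%:E | z in A `*` A].

Definition ediam_pow (k : nat) A : \bar R :=
  (if `[< A = set0 >] then 0 else ediam A ^+ k)%E.

(* The k-dimensional Hausdorff outer measure, up to the usual positive
   normalization factor, which is irrelevant for null sets. *)
Definition hausdorff_delta (k : nat) (delta : R) A : \bar R :=
  ereal_inf [set (\sum_(0 <= i <oo) ediam_pow k (C i))%E |
    C in [set C : nat -> set 'rV[R]_n |
      A `<=` \bigcup_i C i /\ forall i, (ediam (C i) <= delta%:E)%E]].

Definition hausdorff (k : nat) A : \bar R :=
  ereal_sup [set hausdorff_delta k delta A | delta in [set d : R | 0 < d]].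

End Euclidean.

Section Polyhedra.
Context {R : realType} {n : nat}.
Implicit Types (s F K A : set 'rV[R]_n).

Definition conv_hull A : set 'rV[R]_n :=
  [set y | exists (m : nat) (p : 'I_m -> 'rV[R]_n) (w : 'I_m -> R),
    [/\ forall i, A (p i), forall i, 0 <= w i,
        \sum_(i < m) w i = 1 & y = \sum_(i < m) w i *: p i]].

(* Not being contained in an affine subspace a + U of dimension at most k - 1
   (U is the row space of a matrix); no such subspace exists for k = 0. *)
Definition simplex_vertices (k : nat) s (p : 'I_k.+1 -> 'rV[R]_n) : Prop :=
  s = conv_hull (range p) /\
  forall (a : 'rV[R]_n) (U : 'M[R]_n), (\rank U < k)%N ->
    ~ (s `<=` [set y | (y - a <= U)%MS]).

Definition is_simplex (k : nat) s : Prop :=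
  exists p : 'I_k.+1 -> 'rV[R]_n, simplex_vertices s p.

Definition is_face (k : nat) F s : Prop :=
  exists p : 'I_k.+1 -> 'rV[R]_n, simplex_vertices s p /\
    exists I, [/\ I `<=` range p, I !=set0 & F = conv_hull I].

Definition bounded_polyhedron K : Prop :=
  exists (l : nat) (s : 'I_l -> set 'rV[R]_n),
    [/\ forall i, is_simplex n (s i),
        K = \bigcup_i s i
      & forall i j : 'I_l, (i < j)%N ->
          s i `&` s j = set0 \/
          (is_face n (s i `&` s j) (s i) /\ is_face n (s i `&` s j) (s j))].

End Polyhedra.

Section Domains.
Context {R : realType} {n : nat}.
Implicit Types (Om : set 'rV[R]_n) (x e nu : 'rV[R]_n).

(* Near x, the set Om is the strict subgraph of g in the direction of the unit
   vector e. The function g is invariant along e, i.e. it is a Lipschitz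
   function on the hyperplane orthogonal to e. *)
Definition lipschitz_chart Om x e (g : 'rV[R]_n -> R) : Prop :=
  [/\ edot e e = 1,
      lipschitz g,
      forall y (t : R), g (y + t *: e) = g y
    & \forall y \near x, Om y <-> edot y e < g y].

Definition lipschitz_domain Om : Prop :=
  open Om /\
  forall x, boundary Om x -> exists e g, lipschitz_chart Om x e g.

(* Near x, Om is {y | edot y e - g y < 0}; if g is differentiable at x with
   gradient a (orthogonal to e), the outward normal is e - a, normalized. *)
Definition outward_unit_normal Om x nu : Prop :=
  boundary Om x /\
  exists e g a, [/\ lipschitz_chart Om x e g,
    differentiable g x,
    forall v, 'd g x v = edot a v
  & nu = (enorm (e - a))^-1 *: (e - a)].

Definition polyhedral_domain Om : Prop :=
  [/\ lipschitz_domain Om, connected Om & bounded_polyhedron (closure Om)].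

End Domains.

(* C^1 up to the boundary of the open set U: f is of class C^1 in U, and f and
   its first derivatives extend continuously to the closure of U. Only the
   values of f on the closure of U matter. V and W are finite dimensional in
   all uses below. *)
Definition C1_closure {R : realType} {V W : normedModType R} (U : set V)
    (f : V -> W) : Prop :=
  [/\ {within closure U, continuous f},
      forall x, U x -> differentiable f x
    & forall v : V, exists D : V -> W,
        {within closure U, continuous D} /\
        forall x, U x -> 'd f x v = D x].

Section Diffeomorphisms.
Context {R : realType} {n : nat}.
Implicit Types (Om : set 'rV[R]_n) (phi Phi : 'rV[R]_n -> 'rV[R]_n).

(* The boundary condition holds almost everywhere for the surface measure,
   i.e. the (n - 1)-dimensional Hausdorff measure on the boundary. *)
Definition U0 Om phi : Prop :=
  C1_closure Om phi /\
  hausdorff n.-1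
    [set x | boundary Om x /\
      ~ exists nu, outward_unit_normal Om x nu /\ edot (phi x) nu = 0] = 0%E.

(* As for any diffeomorphism, the inverse is also required to be C^1. *)
Definition Diff Om Phi : Prop :=
  [/\ C1_closure Om Phi,
      set_bij (closure Om) (closure Om) Phi
    & exists Psi, C1_closure Om Psi /\
        forall x, closure Om x -> Psi (Phi x) = x].

(* The field X is C^1 up to the boundary jointly in (x, t), the least
   regularity a smooth isotopy between C^1 maps can have. The derivative in t
   is one-sided at t = 0 and t = 1. *)
Definition isotopy Om Phi (X : 'rV[R]_n -> R -> 'rV[R]_n) : Prop :=
  [/\ C1_closure (V := ('rV[R]_n * R^o)%type) (Om `*` [set t : R | 0 < t < 1])
        (fun z => X z.1 z.2),
      forall x, closure Om x -> X x 0 = x,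
      forall x, closure Om x -> X x 1 = Phi x,
      forall t : R, 0 <= t <= 1 -> Diff Om (X ^~ t)
    & forall t : R, 0 <= t <= 1 -> exists Y : 'rV[R]_n -> 'rV[R]_n,
        C1_closure Om Y /\
        forall x, closure Om x ->
          (s - t)^-1 *: (X x s - X x t) @[s --> within `[0, 1] t^']
            --> Y x].

Definition Diff0 Om Phi : Prop := Diff Om Phi /\ exists X, isotopy Om Phi X.

End Diffeomorphisms.

(* Main.v *)
(* Call a point x of K = closure Om regular if K coincides near x with a closed
   half-space. The differential (up to the boundary) of a diffeomorphism f of K
   maps the tangent cone of K at a regular point x onto the tangent cone at
   f x; the former is a half-space, and K, being a polyhedron, coincides near
   f x with the latter, so f x is regular too. Along an isotopy X, the path
   t |-> X x t thus stays in the set of regular points, on which the normal is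
   locally constant along the boundary; hence the path stays in a hyperplane
   and X x 1 - x is orthogonal to the normal at x. Boundary points that are not
   regular lie on finitely many affine subspaces of codimension 2. *)

Require Import Defs.
From HB Require Import structures.
From mathcomp Require Import all_boot all_order all_algebra.
From mathcomp Require Import all_classical all_reals all_analysis.
From mathcomp Require Import ring lra.
Import Order.TTheory GRing.Theory Num.Theory.
Import numFieldNormedType.Exports.
Local Open Scope classical_set_scope.
Local Open Scope ring_scope.

Set Implicit Arguments.
Unset Strict Implicit.
Unset Printing Implicit Defensive.

(** * Scalar product and norm *)

(** The obstacle is that regular points lie on the boundary, while [C1_closure] gives derivatives
    only inside [Om], with continuous extensions. A first-order expansion along the closure is
    recovered by joining a point to its neighbours through [Om] by paths of comparable length; this
    is where the Lipschitz charts enter. Expanding a diffeomorphism and its inverse makes the two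
    differentials mutually inverse matrices, so that a half-space goes to a half-space. Such
    expansions control K near the image point to first order only; exact coincidence with a
    half-space comes from the invariance of a polyhedron under small scalings about any point. *)

Lemma near_normP (R : realType) (V : normedModType R) (p : V) (P : V -> Prop) :
  (\forall y \near p, P y) <->
  exists2 r : R, 0 < r & forall y, `|y - p| < r -> P y.
Proof.
rewrite nbhs_normP; split=> -[r r0 H]; exists r => //.
  by move=> y yr; apply: H; rewrite /ball_ /= distrC.
by move=> y; rewrite /ball_ /= distrC => /H.
Qed.

Lemma le_mul_epsilon (R : realType) (x c : R) :
  (forall eps, 0 < eps -> x <= c * eps) -> x <= 0.
Proof.
move=> H; rewrite leNgt; apply/negP => x0.
have c0 : 0 < c.
  by have := H 1 ltr01; rewrite mulr1; exact: lt_le_trans.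
have := H (x / c / 2) _; rewrite !divr_gt0// => /(_ isT).
have -> : c * (x / c / 2) = x / 2 by field; rewrite gt_eqF.
lra.
Qed.

Lemma half_lt (R : realType) (x : R) : 0 < x -> x / 2 < x.
Proof. by move=> x0; rewrite ltr_pdivrMr// ltr_pMr// ltr1n. Qed.

Lemma exists_small_scale (R : realType) (V : normedModType R) (v : V) (r : R) :
  0 < r -> exists2 s : R, 0 < s & `|s *: v| < r.
Proof.
(* Adding 1 keeps the divisor positive when v = 0; the same device recurs below. *)
move=> r0; have v1 : 0 < `|v| + 1 by rewrite ltr_wpDl.
exists (r / (`|v| + 1) / 2); first by rewrite !divr_gt0.
rewrite normrZ gtr0_norm ?divr_gt0//.
apply: (@le_lt_trans _ _ (r / (`|v| + 1) / 2 * (`|v| + 1))).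
  by rewrite ler_pM2l ?divr_gt0// lerDl.
by rewrite mulrAC divfK ?gt_eqF// half_lt.
Qed.

Section euclidean.
Context {R : realType} {n : nat}.
Implicit Types (x y z v w a : 'rV[R]_n).

Lemma norm_coord v i : `|v 0 i| <= `|v|.
Proof.
rewrite [leRHS]mx_normrE.
exact: (le_bigmax_cond 0 (fun ij : 'I_1 * 'I_n => `|v ij.1 ij.2|) (j := (0, i))).
Qed.

Lemma norm_le_coord v c : 0 <= c -> (forall i, `|v 0 i| <= c) -> `|v| <= c.
Proof.
move=> c0 H; rewrite [leLHS]mx_normrE; apply: bigmax_le => // -[j i] _ /=.
by rewrite ord1.
Qed.

Lemma edotE x y : edot x y = (x *m y^T) 0 0.
Proof. by rewrite mxE; apply: eq_bigr => i _; rewrite mxE. Qed.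

Lemma edotC x y : edot x y = edot y x.
Proof. by apply: eq_bigr => i _; rewrite mulrC. Qed.

Lemma edotDl x y z : edot (x + y) z = edot x z + edot y z.
Proof. by rewrite !edotE mulmxDl mxE. Qed.

Lemma edotZl c x z : edot (c *: x) z = c * edot x z.
Proof. by rewrite !edotE -scalemxAl mxE. Qed.

Lemma edotNl x z : edot (- x) z = - edot x z.
Proof. by rewrite -scaleN1r edotZl mulN1r. Qed.

Lemma edotBl x y z : edot (x - y) z = edot x z - edot y z.
Proof. by rewrite edotDl edotNl. Qed.

Lemma edotDr x y z : edot z (x + y) = edot z x + edot z y.
Proof. by rewrite edotC edotDl ![edot _ z]edotC. Qed.

Lemma edotZr c x z : edot z (c *: x) = c * edot z x.
Proof. by rewrite edotC edotZl edotC. Qed.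

Lemma edotNr x z : edot z (- x) = - edot z x.
Proof. by rewrite edotC edotNl edotC. Qed.

Lemma edotBr x y z : edot z (x - y) = edot z x - edot z y.
Proof. by rewrite edotDr edotNr. Qed.

Lemma edot0l z : edot 0 z = 0.
Proof. by rewrite edotE mul0mx mxE. Qed.

Lemma edot0r z : edot z 0 = 0.
Proof. by rewrite edotC edot0l. Qed.

Lemma edot_suml (I : finType) (F : I -> 'rV[R]_n) z :
  edot (\sum_i F i) z = \sum_i edot (F i) z.
Proof.
rewrite edotE mulmx_suml summxE; apply: eq_bigr => i _; by rewrite edotE.
Qed.

Lemma edot_ge0 x : 0 <= edot x x.
Proof. by apply: sumr_ge0 => i _; rewrite -expr2 sqr_ge0. Qed.

Lemma edot_eq0 x : (edot x x == 0) = (x == 0).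
Proof.
apply/idP/eqP => [|->]; last by rewrite edot0l.
rewrite psumr_eq0 => [/allP H|i _]; last by rewrite -expr2 sqr_ge0.
apply/rowP => i; rewrite mxE; apply/eqP.
by have := H i (mem_index_enum _); rewrite /= mulf_eq0 orbb.
Qed.

Lemma edot_gt0 x : x != 0 -> 0 < edot x x.
Proof. by move=> x0; rewrite lt_neqAle eq_sym edot_eq0 x0 edot_ge0. Qed.

Lemma edot_bounded a : exists2 c, 0 < c & forall v, `|edot v a| <= c * `|v|.
Proof.
exists (1 + \sum_i `|a 0 i|); first by rewrite ltr_pwDl// sumr_ge0.
move=> v; apply: (@le_trans _ _ (\sum_i `|a 0 i| * `|v|)).
  apply: le_trans (ler_norm_sum _ _ _) _; apply: ler_sum => i _.
  by rewrite normrM mulrC ler_wpM2l// norm_coord.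
by rewrite -mulr_suml ler_wpM2r// lerDr.
Qed.

Lemma mulmx_bounded (A : 'M[R]_n) :
  exists2 c, 0 < c & forall v, `|v *m A| <= c * `|v|.
Proof.
exists (1 + \sum_i \sum_j `|A i j|).
  by rewrite ltr_pwDl// sumr_ge0// => i _; rewrite sumr_ge0.
move=> v; apply: norm_le_coord => [|j].
  by rewrite mulr_ge0// addr_ge0// sumr_ge0// => i _; rewrite sumr_ge0.
rewrite mxE; apply: le_trans (ler_norm_sum _ _ _) _.
apply: (@le_trans _ _ (\sum_i `|A i j| * `|v|)).
  by apply: ler_sum => i _; rewrite normrM mulrC ler_wpM2l// norm_coord.
rewrite -mulr_suml ler_wpM2r//; apply: (@le_trans _ _ (\sum_i \sum_j `|A i j|)).
  apply: ler_sum => i _; rewrite (bigD1 j)//= lerDl; exact: sumr_ge0.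
by rewrite lerDr.
Qed.

Lemma edot_mulmx (B : 'M[R]_n) v a : edot (v *m B) a = edot v (a *m B^T).
Proof. by rewrite !edotE trmx_mul trmxK mulmxA. Qed.

(** The sharp factor is the square root of n; [n.+1] is cruder but positive even for n = 0. *)
Lemma enorm_le v : enorm v <= n.+1%:R * `|v|.
Proof.
rewrite /enorm -[leRHS]ger0_norm ?mulr_ge0// -sqrtr_sqr ler_wsqrtr//.
apply: (@le_trans _ _ (\sum_(i < n) `|v| ^+ 2)).
  apply: ler_sum => i _; rewrite -expr2 -real_normK ?num_real//.
  by rewrite lerXn2r ?nnegrE// norm_coord.
rewrite sumr_const card_ord -[leLHS]mulr_natl exprMn ler_wpM2r ?sqr_ge0//.
by rewrite -natrX ler_nat (leq_trans (leqnSn n))// leq_pmulr.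
Qed.

End euclidean.

(** * Differentiability up to the boundary *)

Lemma within_continuous_normP (R : realType) (V W : normedModType R)
    (A : set V) (f : V -> W) :
  {within A, continuous f} <->
  forall x, A x -> forall eps, 0 < eps ->
    \forall y \near x, A y -> `|f y - f x| < eps.
Proof.
rewrite subspace_continuousP; split=> H x Ax.
  move=> e e0; have /cvgr_dist_lt /(_ _ e0) := H x Ax.
  rewrite near_withinE; apply: filterS => y Hy Ay; rewrite distrC; exact: Hy.
apply/cvgrPdist_lt => e e0; rewrite near_withinE; have := H x Ax e e0.
by apply: filterS => y Hy Ay; rewrite distrC; apply: Hy.
Qed.

Lemma continuous_at_normP (R : realType) (V W : normedModType R)
    (f : V -> W) x : (forall eps, 0 < eps ->
    \forall y \near x, `|f y - f x| < eps) -> f y @[y --> x] --> f x.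
Proof.
move=> H; apply/cvgrPdist_lt => e e0; have := H e e0.
by apply: filterS => y; rewrite distrC.
Qed.

Lemma near_forall (R : realType) (V : normedModType R) (I : finType)
    (P : I -> V -> Prop) (p : V) : (forall i, \forall y \near p, P i y) ->
  \forall y \near p, forall i, P i y.
Proof. exact: filter_forall. Qed.

(** * Mean value inequality on segments *)

Section mvt.
Context {R : realType} {n : nat}.
Implicit Types (K Om : set 'rV[R]_n) (a v : 'rV[R]_n) (h : 'rV[R]_n -> 'rV[R]_n).

Lemma is_derive_line h a v i (s : R) : differentiable h (a + s *: v) ->
  is_derive s 1 (fun u : R => h (a + u *: v) 0 i) ('d h (a + s *: v) v 0 i).
Proof.
move=> dh.
have dl : is_diff s (fun u : R => a + u *: v) (fun u => u *: v).
  have : is_diff s (cst a + ( *:%R^~ v)) (0 + ( *:%R^~ v)).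
    by apply: is_diffD.
  by rewrite add0r.
have dc : is_diff s (h \o (fun u : R => a + u *: v))
    ('d h (a + s *: v) \o (fun u => u *: v)).
  apply: is_diff_comp; exact: DiffDef.
have H : derivable (h \o (fun u : R => a + u *: v)) s 1.
  exact/derivable1_diffP.
apply: DeriveDef; first by move/derivable_mxP : H; apply.
have := derive_mx H; rewrite deriveE; last exact/derivable1_diffP.
by rewrite diff_val /= scale1r => ->; rewrite mxE.
Qed.

(** There is no mean value equality for vector-valued maps, but the max norm lets each coordinate be
    treated separately without loss. The ends of the segment may lie on the boundary, where only
    continuity along K is available. *)
Lemma segment_mvt K Om h a v c : {within K, continuous h} ->
  (forall x, Om x -> differentiable h x) ->
  (forall s, 0 <= s <= 1 -> K (a + s *: v)) ->
  (forall s, 0 < s < 1 -> Om (a + s *: v)) ->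
  0 <= c -> (forall s, 0 < s < 1 -> `|'d h (a + s *: v) v| <= c) ->
  `|h (a + v) - h a| <= c.
Proof.
move=> hc hd Kav Oav c0 bd; apply: norm_le_coord => // i.
have [||u] := @MVT R (fun u : R => h (a + u *: v) 0 i)
  (fun s => 'd h (a + s *: v) v 0 i) 0 1 ltr01.
- by move=> u; rewrite in_itv/= => u01; apply/is_derive_line/hd/Oav.
- apply/within_continuous_normP => s; rewrite /= in_itv/= => s01 eps eps0.
  move/within_continuous_normP : hc => /(_ _ (Kav _ s01) _ eps0).
  move=> /near_normP[r r0 H]; apply/near_normP.
  have v1 : 0 < `|v| + 1 by rewrite ltr_wpDl.
  exists (r / (`|v| + 1)); first by rewrite divr_gt0.
  move=> u us; rewrite /= in_itv/= => u01.
  have au : `|a + u *: v - (a + s *: v)| < r.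
    rewrite opprD addrACA subrr add0r -scalerBl normrZ.
    rewrite (@le_lt_trans _ _ (`|u - s| * (`|v| + 1)))//.
      by rewrite ler_wpM2l// lerDl.
    by rewrite -ltr_pdivlMr.
  apply: le_lt_trans (H _ au (Kav _ u01)).
  by have := norm_coord (h (a + u *: v) - h (a + s *: v)) i; rewrite !mxE.
rewrite in_itv/= => u01.
rewrite scale0r scale1r addr0 subr0 mulr1 !mxE => ->.
exact: le_trans (norm_coord _ _) (bd _ u01).
Qed.

End mvt.

Section closure.
Context {R : realType} {n : nat}.
Implicit Types (Om : set 'rV[R]_n) (x y p e v : 'rV[R]_n).

Lemma closure_normP Om y :
  closure Om y <-> forall r, 0 < r -> exists2 z, Om z & `|z - y| < r.
Proof.
split=> [H r r0|H B yB]; last first.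
  have /near_normP[r r0 HB] : \forall z \near y, B z by exact: yB.
  by have [z Oz zr] := H r r0; exists z; split=> //; apply: HB.
have [|z [Oz zr]] := H [set z | `|z - y| < r]; last by exists z.
by apply/(@near_normP _ _ y); exists r.
Qed.

Lemma lipschitz_bounded (g : 'rV[R]_n -> R) : lipschitz g ->
  exists2 M, 0 < M & forall x y, `|g x - g y| <= M * `|x - y|.
Proof.
case=> M [_ H]; exists (`|M| + 1); first by rewrite ltr_wpDl.
move=> x y; apply: (H (`|M| + 1) _ (x, y)) => //.
by rewrite (le_lt_trans (ler_norm M))// ltrDl.
Qed.

(** The strict inequality of the chart weakens in the limit: [edot _ e] and g are both Lipschitz, so
    a point of [Om] within eps of y gives the bound up to [(ce + M) * eps]. *)
Lemma chart_closure_le Om p e g r : 0 < r -> lipschitz g ->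
  (forall y, `|y - p| < r -> (Om y <-> edot y e < g y)) ->
  forall y, `|y - p| < r -> closure Om y -> edot y e <= g y.
Proof.
move=> r0 /lipschitz_bounded[M M0 Mg] HO y yr /closure_normP Oy.
rewrite -subr_le0; have [ce ce0 Hce] := edot_bounded e.
apply: (@le_mul_epsilon _ _ (ce + M)) => eps eps0.
have [|z Oz] := Oy (Num.min eps (r - `|y - p|)).
  by rewrite lt_min eps0 subr_gt0.
rewrite lt_min => /andP[zy zr].
have /HO : `|z - p| < r.
  by rewrite -(subrK y z) -addrA (le_lt_trans (ler_normD _ _))// -ltrBrDr.
case=> /(_ Oz) zg _.
have := Hce (z - y); rewrite edotBl => /ler_normlP[H1 _].
have := Mg z y => /ler_normlP[_ H2].
have : ce * `|z - y| <= ce * eps by rewrite ler_pM2l// ltW.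
have : M * `|z - y| <= M * eps by rewrite ler_pM2l// ltW.
lra.
Qed.

End closure.

(** * Paths inside a Lipschitz domain *)

Section within_diff.
Context {R : realType} {n : nat}.
Implicit Types (Om : set 'rV[R]_n) (x y p e v : 'rV[R]_n).

(** Stands for a path from p to y through [Om], of length at most C |y - p| and within that distance
    of p; only the mean value inequality that it yields is recorded. Quantifying over h allows its
    use on a map minus its candidate linear part. *)
Definition path_bound Om p C y := forall (h : 'rV[R]_n -> 'rV[R]_n) c,
  0 <= c -> {within closure Om, continuous h} ->
  (forall x, Om x -> differentiable h x) ->
  (forall z v, Om z -> `|z - p| <= C * `|y - p| -> `|'d h z v| <= c * `|v|) ->
  `|h y - h p| <= C * c * `|y - p|.

Lemma path_bound_interior Om p : open Om -> Om p ->
  \forall y \near p, path_bound Om p 1 y.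
Proof.
move=> oO Op; have /near_normP[r r0 H] : \forall y \near p, Om y.
  exact: open_nbhs_nbhs.
apply/near_normP; exists r => // y yr h c c0 hc hd bd.
have seg s : 0 <= s <= 1 -> `|p + s *: (y - p) - p| <= `|y - p|.
  move=> /andP[s0 s1]; rewrite addrC addKr normrZ ger0_norm//.
  by rewrite ler_piMl.
have inO s : 0 <= s <= 1 -> Om (p + s *: (y - p)).
  by move=> /seg ?; apply: H; apply: le_lt_trans yr.
have -> : h y = h (p + (y - p)) by rewrite [p + _]addrC subrK.
rewrite mul1r.
apply: (segment_mvt (K := closure Om) (Om := Om)) => //.
- by move=> s /inO; exact: subset_closure.
- by move=> s /andP[s0 s1]; apply: inO; rewrite !ltW.
- by rewrite mulr_ge0.
- move=> s /andP[s0 s1]; apply: bd; first by apply: inO; rewrite !ltW.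
  by rewrite mul1r seg// !ltW.
Qed.

(* A point y of the closure is reached from p by moving down in the chart by
   T = L |y - p|, then along y - p, then up by T. *)
Lemma path_bound_chart Om p e g : closure Om p -> lipschitz_chart Om p e g ->
  exists2 C, 0 < C & \forall y \near p, closure Om y -> path_bound Om p C y.
Proof.
move=> Kp [ee lg ginv /near_normP[r r0 HO]].
have [M M0 Mg] := lipschitz_bounded lg.
have [ce ce0 Hce] := edot_bounded e.
have e1 : `|e| <= 1.
  apply: norm_le_coord => // i; rewrite -(@expr_le1 _ 2)// real_normK ?num_real//.
  rewrite -ee /edot (bigD1 i)//= expr2 lerDl sumr_ge0// => j _.
  by rewrite -expr2 sqr_ge0.
(* With d = |y - p|, moving across raises [edot _ e] by at most ce d and lowers g by at most M d.
   Descending by L d first leaves a margin of d below the graph. *)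
pose L := ce + M + 1.
have L0 : 0 < L by rewrite /L; lra.
(* Total length in units of d: L down, 1 across, L up. *)
have C0 : 0 < 2 * L + 1 by lra.
exists (2 * L + 1) => //; apply/near_normP; exists (r / (2 * L + 1)).
  by rewrite divr_gt0.
move=> y; rewrite ltr_pdivlMr// mulrC => yr Ky h c c0 hc hd bd.
have [->|yp] := eqVneq y p; first by rewrite !subrr !normr0 mulr0.
set d := `|y - p| in yr bd *.
have d0 : 0 < d by rewrite normr_gt0 subr_eq0.
have Kle := chart_closure_le r0 lg HO.
have [pr yr'] : `|p - p| < r /\ `|y - p| < r.
  rewrite subrr normr0; split=> //; apply: le_lt_trans yr.
  by rewrite ler_peMl//; lra.
pose T := L * d; have T0 : 0 < T by rewrite mulr_gt0.
have Te s : 0 <= s <= T -> `|(- s) *: e| <= T.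
  move=> /andP[s0 sT]; rewrite normrZ normrN ger0_norm//.
  by apply: le_trans sT; rewrite ler_piMr.
have down q s : closure Om q -> `|q - p| <= d -> 0 < s <= T ->
    `|q + (- s) *: e - p| <= (2 * L + 1) * d /\ Om (q + (- s) *: e).
  move=> Kq qd /andP[s0 sT].
  have qs : `|q + (- s) *: e - p| <= (2 * L + 1) * d.
    rewrite addrAC (le_trans (ler_normD _ _))//.
    have := Te s; rewrite sT ltW// => /(_ isT).
    rewrite /T; nra.
  split=> //; apply/HO; first exact: le_lt_trans yr.
  rewrite ginv edotDl edotZl ee.
  have := Kle q (le_lt_trans qd yr') Kq; lra.
have across s : 0 <= s <= 1 ->
    let z := p + (- T) *: e + s *: (y - p) in
    `|z - p| <= (2 * L + 1) * d /\ Om z.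
  move=> /andP[s0 s1] z.
  have zd : `|z - p| <= (2 * L + 1) * d.
    have -> : z - p = (- T) *: e + s *: (y - p).
      by apply/eqP; rewrite subr_eq [eqbRHS]addrC addrA.
    rewrite (le_trans (ler_normD _ _))//.
    have := Te T; rewrite ltW//= lexx => /(_ isT).
    rewrite [`|s *: _|]normrZ (ger0_norm s0) -/d /T.
    have : s * d <= 1 * d by rewrite ler_pM2r.
    nra.
  split=> //; apply/HO; first exact: le_lt_trans yr.
  rewrite /z addrAC ginv edotDl edotZl ee edotDl edotZl.
  have := Hce (y - p) => /ler_normlP[_]; rewrite -/d => H1.
  have := Mg (p + s *: (y - p)) p => /ler_normlP[+ _].
  rewrite addrAC subrr add0r normrZ (ger0_norm s0) -/d => H2.
  have := Kle p pr Kp.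
  have : s * edot (y - p) e <= s * (ce * d) by rewrite ler_wpM2l.
  have : s * (ce * d) <= ce * d by rewrite ler_piMl// ltW// mulr_gt0.
  have : M * (s * d) <= M * d by rewrite ler_pM2l// ler_piMl// ltW.
  rewrite /T /L mulrDl mulrDl mul1r; lra.
have vert q : closure Om q -> `|q - p| <= d ->
    `|h (q + (- T) *: e) - h q| <= c * T.
  move=> Kq qd; apply: (segment_mvt (K := closure Om) (Om := Om)) => //.
  - move=> s /andP[]; rewrite le_eqVlt => /predU1P[<- _|s0 s1].
      by rewrite scale0r addr0.
    rewrite scalerA mulrN; apply: subset_closure; apply: (down q _ Kq qd _).2.
    by rewrite mulr_gt0// ler_piMl// ltW.
  - move=> s /andP[s0 s1]; rewrite scalerA mulrN; apply: (down q _ Kq qd _).2.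
    by rewrite mulr_gt0// ler_piMl// ltW.
  - by rewrite mulr_ge0// ltW.
  - move=> s /andP[s0 s1]; rewrite scalerA mulrN.
    have [] := down q (s * T) Kq qd.
      by rewrite mulr_gt0// ler_piMl// ltW.
    move=> H1 H2; apply: le_trans (bd _ _ H2 H1) _.
    by rewrite ler_wpM2l// Te// lexx ltW.
have horiz : `|h (p + (- T) *: e + (y - p)) - h (p + (- T) *: e)| <= c * d.
  apply: (segment_mvt (K := closure Om) (Om := Om)) => //.
  - by move=> s /across[_ Os]; exact: subset_closure.
  - by move=> s /andP[s0 s1]; apply: (across s _).2; rewrite !ltW.
  - by rewrite mulr_ge0// ltW.
  - move=> s /andP[s0 s1]; have [|H1 H2] := across s; first by rewrite !ltW.
    exact: bd.
have vp : `|h (p + (- T) *: e) - h p| <= c * T.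
  by apply: vert => //; rewrite subrr normr0 ltW.
have vy := vert y Ky (lexx _).
rewrite [p + _ + _]addrC addrA subrK in horiz.
have -> : h y - h p = - (h (y + (- T) *: e) - h y) +
    (h (y + (- T) *: e) - h (p + (- T) *: e)) + (h (p + (- T) *: e) - h p).
  by rewrite opprB !subrKA.
rewrite (le_trans (ler_normD _ _))//.
rewrite (le_trans (lerD (ler_normD _ _) (lexx _)))// normrN.
move: vp vy horiz; rewrite /T; lra.
Qed.

Lemma path_bound_lipschitz Om p : lipschitz_domain Om -> closure Om p ->
  exists2 C, 0 < C & \forall y \near p, closure Om y -> path_bound Om p C y.
Proof.
move=> [oO HO] Kp; have [Op|nOp] := pselect (Om p).
  exists 1 => //; have := path_bound_interior oO Op.
  by apply: filterS => y H _.
have [|e [g Hg]] := HO p; last exact: path_bound_chart Hg.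
by split=> // /interior_subset.
Qed.

End within_diff.

(** * First-order expansions along the closure *)

Section diff_within.
Context {R : realType} {n : nat}.
Implicit Types (Om K : set 'rV[R]_n) (x y p e v : 'rV[R]_n)
  (f g : 'rV[R]_n -> 'rV[R]_n) (A B : 'M[R]_n).

(** Replaces [differentiable] at boundary points, since f is arbitrary off K. The matrix acts on row
    vectors from the right, so the differential of a composite [g \o f] reads [A *m B]. *)
Definition diff_within K f x A := forall eps, 0 < eps ->
  \forall y \near x, K y -> `|f y - f x - (y - x) *m A| <= eps * `|y - x|.

Lemma mulmxr_continuous A : continuous (fun y : 'rV[R]_n => y *m A).
Proof.
move=> x; apply: continuous_at_normP => eps eps0; apply/near_normP.
have [c c0 Ac] := mulmx_bounded A.
exists (eps / c); rewrite ?divr_gt0// => y.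
rewrite ltr_pdivlMr// mulrC -mulmxBl; exact: le_lt_trans.
Qed.

Lemma is_diff_mulmxr A x :
  is_diff x (fun y : 'rV[R]_n => y *m A) (fun v => v *m A).
Proof.
have c := @mulmxr_continuous A.
apply: DiffDef; first exact: (linear_differentiable (f := mulmxr A)).
exact: (diff_lin (f := mulmxr A)).
Qed.

Lemma diff_sum_delta f x v :
  'd f x v = \sum_i v 0 i *: ('d f x (delta_mx 0 i) : 'rV[R]_n).
Proof.
rewrite {1}(row_sum_delta v) linear_sum; apply: eq_bigr => i _.
by rewrite linearZ.
Qed.

(** The rows of A are the continuous extensions at p of the partial derivatives. Subtracting the
    linear map A leaves a map whose differential is small on [Om] near p, and the path bound turns
    this smallness into the required estimate. *)
Lemma C1_diff_within Om f p : lipschitz_domain Om -> C1_closure Om f ->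
  closure Om p -> exists A, diff_within (closure Om) f p A.
Proof.
move=> Omlip [hc hd hD] Kp.
have [D HD] := choice (fun i : 'I_n => hD (delta_mx 0 i)).
pose A : 'M[R]_n := \matrix_i D i p; exists A => eps eps0.
have [C C0 HC] := path_bound_lipschitz Omlip Kp.
(* Dividing by C offsets the path constant; the later division by [n.+1] offsets the sum over n
   partial derivatives and is safe for n = 0. *)
pose eta := eps / C; have eta0 : 0 < eta by rewrite divr_gt0.
have : \forall z \near p, forall i, closure Om z ->
    `|D i z - D i p| < eta / n.+1%:R.
  apply: near_forall => i; have [/within_continuous_normP DC _] := HD i.
  by apply: DC => //; rewrite divr_gt0.
move=> /near_normP[r r0 Hr].
have : \forall y \near p, C * `|y - p| < r.
  apply/near_normP; exists (r / C); rewrite ?divr_gt0// => y.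
  by rewrite ltr_pdivlMr// mulrC.
apply: filterS2 HC => y Hy yr Ky.
pose l z : 'rV[R]_n := z *m A.
have dA z : is_diff z l l by exact: is_diff_mulmxr.
have dlE z v : 'd l z v = v *m A by case: (dA z) => _ ->.
have -> : f y - f p - (y - p) *m A = (f - l) y - (f - l) p.
  rewrite !fctE /l mulmxBl !opprB addrACA [RHS]addrACA.
  by rewrite [- f p + _]addrC.
have -> : eps = C * eta by rewrite /eta mulrC divfK ?gt_eqF.
apply: (Hy Ky); first exact: ltW.
- change {within closure Om, continuous (fun y => f y - l y)} => z.
  apply: continuousB; first exact: hc.
  by apply: continuous_subspaceT; exact: mulmxr_continuous.
- by move=> z Oz; apply: differentiableB => //; exact: hd.
- move=> z v Oz zC.
  have zr : `|z - p| < r by apply: le_lt_trans yr.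
  have -> : 'd (f - l) z v = \sum_i v 0 i *: (D i z - D i p).
    rewrite diffB//; last exact: hd.
    change ('d f z v - 'd l z v = \sum_i v 0 i *: (D i z - D i p)).
    transitivity ('d f z v - v *m A).
      congr (_ - _).
      exact: dlE.
    rewrite diff_sum_delta /l mulmx_sum_row -sumrB.
    apply: eq_bigr => i _; rewrite rowK -scalerBr.
    by have [_ ->] := HD i.
  apply: le_trans (ler_norm_sum _ _ _) _.
  apply: (@le_trans _ _ (\sum_(i < n) (eta / n.+1%:R) * `|v|)).
    apply: ler_sum => i _; rewrite normrZ mulrC.
    apply: ler_pM => //; last exact: norm_coord.
    by apply/ltW/Hr => //; exact: subset_closure.
  rewrite sumr_const card_ord -mulrnAl ler_wpM2r//.
  rewrite -[leLHS]mulr_natr -mulrA ler_piMr ?(ltW eta0)//.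
  by rewrite mulrC ler_pdivrMr// mul1r ler_nat.
Qed.

Lemma diff_within_dir K f x A v : diff_within K f x A ->
  forall eps, 0 < eps -> exists2 d, 0 < d & forall s, 0 < s < d ->
    K (x + s *: v) -> `|f (x + s *: v) - f x - s *: (v *m A)| <= eps * s.
Proof.
move=> fA eps eps0; have v1 : 0 < `|v| + 1 by rewrite ltr_wpDl.
have /near_normP[r r0 H] := fA (eps / (`|v| + 1)) (divr_gt0 eps0 v1).
exists (r / (`|v| + 1)); rewrite ?divr_gt0// => s /andP[s0 sr] Ksv.
have E : x + s *: v - x = s *: v by rewrite [x + _]addrC addrK.
have := H (x + s *: v); rewrite E -scalemxAl normrZ gtr0_norm//.
move=> /(_ _ Ksv) Hs; apply: le_trans (Hs _) _.
- apply: le_lt_trans (_ : s * (`|v| + 1) < r).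
    by rewrite ler_pM2l// lerDl.
  by rewrite -ltr_pdivlMr.
- rewrite [s * _]mulrC mulrA ler_pM2r// mulrAC ler_pdivrMr// ler_pM2l//.
  by rewrite lerDl.
Qed.

Lemma diff_within_comp K f g x A B : (forall y, K y -> K (f y)) ->
  diff_within K f x A -> diff_within K g (f x) B ->
  diff_within K (g \o f) x (A *m B).
Proof.
move=> fK fA gB eps eps0.
have [cA cA0 HA] := mulmx_bounded A; have [cB cB0 HB] := mulmx_bounded B.
(* The cap 1 in e2 gives |f y - f x| <= (cA + 1) |y - x|; each of the two errors then costs at most
   half of eps |y - x|. *)
pose e1 := eps / (2 * (cA + 1)); pose e2 := Num.min 1 (eps / (2 * cB)).
have e10 : 0 < e1 by rewrite divr_gt0// mulr_gt0// addr_gt0.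
have e20 : 0 < e2 by rewrite lt_min ltr01 divr_gt0// mulr_gt0.
have /near_normP[r r0 Hg] := gB e1 e10.
have : \forall y \near x, `|y - x| < r / (cA + 1).
  by apply/near_normP; exists (r / (cA + 1)) => //; rewrite divr_gt0// addr_gt0.
apply: filterS2 (fA e2 e20) => y Hf yr Ky; have {}Hf := Hf Ky.
set k := f y - f x in Hf; set d := `|y - x| in Hf yr *.
have d0 : 0 <= d by exact: normr_ge0.
have e2d : e2 * d <= d by rewrite ler_piMl// ge_min lexx.
have kd : `|k| <= (cA + 1) * d.
  rewrite -(subrK ((y - x) *m A) k) (le_trans (ler_normD _ _))//.
  by have := HA (y - x); rewrite -/d; lra.
have kr : `|k| < r.
  by apply: le_lt_trans kd _; rewrite mulrC -ltr_pdivlMr// addr_gt0.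
have := Hg (f y) kr (fK _ Ky); rewrite -/k /= => Hk.
have -> : g (f y) - g (f x) - (y - x) *m (A *m B) =
    (g (f y) - g (f x) - k *m B) + (k - (y - x) *m A) *m B.
  by rewrite [(k - _) *m B]mulmxBl addrA subrK mulmxA.
rewrite (le_trans (ler_normD _ _))//.
have H1 : e1 * `|k| <= eps / 2 * d.
  apply: (@le_trans _ _ (e1 * ((cA + 1) * d))); first by rewrite ler_pM2l.
  rewrite mulrA ler_wpM2r// /e1 invfM mulrA divfK ?lexx//.
  by rewrite gt_eqF// addr_gt0.
have H2 : cB * `|k - (y - x) *m A| <= eps / 2 * d.
  apply: (@le_trans _ _ (cB * (e2 * d))); first by rewrite ler_pM2l.
  rewrite mulrA ler_wpM2r// mulrC -ler_pdivlMr//.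
  by rewrite /e2 ge_min -[_ / 2 / _]mulrA -invfM lexx orbT.
have := HB (k - (y - x) *m A); lra.
Qed.

End diff_within.

(** * Regular points *)

Section halfspace.
Context {R : realType} {n : nat}.
Implicit Types (K : set 'rV[R]_n) (x y p q v nu mu : 'rV[R]_n)
  (f g : 'rV[R]_n -> 'rV[R]_n) (A B : 'M[R]_n).

(** The half-space has x on its bounding hyperplane, so interior points of K do not qualify. *)
Definition locally_halfspace K x nu :=
  nu != 0 /\ \forall y \near x, K y <-> edot (y - x) nu <= 0.

(** The equivalence is used both ways: shrinking v reaches scales where a linearization is accurate,
    and enlarging brings the conclusion back. *)
Definition locally_conical K p := exists2 r, 0 < r & forall v s,
  `|v| < r -> 0 < s <= 1 -> (K (p + v) <-> K (p + s *: v)).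

Lemma locally_halfspace_mem K x nu : locally_halfspace K x nu -> K x.
Proof. by case=> _ /nbhs_singleton H; apply/H; rewrite subrr edot0l. Qed.

Lemma locally_halfspace_dir K x nu v : locally_halfspace K x nu ->
  exists2 d, 0 < d & forall s, 0 < s < d ->
    (K (x + s *: v) <-> edot v nu <= 0).
Proof.
case=> nu0 /near_normP[r r0 H]; have v1 : 0 < `|v| + 1 by rewrite ltr_wpDl.
exists (r / (`|v| + 1)); rewrite ?divr_gt0// => s /andP[s0 sr].
have := H (x + s *: v); rewrite [x + _]addrC addrK edotZl pmulr_rle0//; apply.
rewrite normrZ gtr0_norm//; apply: le_lt_trans (_ : s * (`|v| + 1) < r).
  by rewrite ler_pM2l// lerDl.
by rewrite -ltr_pdivlMr.
Qed.

Lemma row_mulmx_inj A B : (forall v, v *m A = v *m B) -> A = B.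
Proof. by move=> H; apply/row_matrixP => i; rewrite !rowE H. Qed.

(* A is only tested on the directions of a half-space, which span the space. *)
Lemma diff_within_id_unique K g x nu A : locally_halfspace K x nu ->
  (forall y, K y -> g y = y) -> diff_within K g x A -> A = 1%:M.
Proof.
move=> Knu gid gA.
have Kx := locally_halfspace_mem Knu.
have half v : edot v nu <= 0 -> v *m A = v.
  move=> vnu; apply/eqP; rewrite -subr_eq0 -normr_eq0 eq_le normr_ge0 andbT.
  apply: (@le_mul_epsilon _ _ 1) => eps eps0; rewrite mul1r.
  have [d d0 Hd] := diff_within_dir v gA eps0.
  have [d' d'0 Hd'] := locally_halfspace_dir v Knu.
  pose s := Num.min d d' / 2.
  have m0 : 0 < Num.min d d' by rewrite lt_min d0.
  have s0 : 0 < s by rewrite divr_gt0.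
  have : s < Num.min d d' by exact: half_lt.
  rewrite lt_min => /andP[sd sd'].
  have Ks : K (x + s *: v) by apply/Hd'; rewrite ?s0.
  have := Hd s; rewrite s0 sd => /(_ isT Ks).
  rewrite (gid _ Ks) (gid _ Kx) [x + _]addrC addrK -scalerBr normrZ gtr0_norm//.
  by rewrite mulrC ler_pM2r// distrC.
apply: row_mulmx_inj => v; rewrite mulmx1.
have [|/ltW vnu] := leP (edot v nu) 0; first exact: half.
by apply: oppr_inj; rewrite -mulNmx half// edotNl oppr_le0.
Qed.

(* The tangent cone of K at f x is the image by A of the one at x, hence a
   half-space, and K coincides near f x with its tangent cone. *)
Lemma locally_halfspace_image K f g x nu A B : closed K ->
  (forall y, K y -> K (f y)) -> (forall y, K y -> K (g y)) ->
  (forall y, K y -> g (f y) = y) ->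
  diff_within K f x A -> diff_within K g (f x) B ->
  locally_conical K (f x) -> locally_halfspace K x nu ->
  exists mu, locally_halfspace K (f x) mu.
Proof.
move=> Kcl fK gK gfK fA gB [r r0 Kcone] Knu.
have Kx := locally_halfspace_mem Knu.
have AB1 : A *m B = 1%:M.
  exact: (diff_within_id_unique Knu gfK (diff_within_comp fK fA gB)).
have BA1 := mulmx1C AB1.
(* Normals transform by the transposed inverse: pairing v with [nu *m B^T] is pairing [v *m B] with
   nu, and B inverts A. *)
exists (nu *m B^T); split.
  apply: contra_not_neq (negP (proj1 Knu)) => nuB0.
  rewrite -edot_eq0 -{1}[nu]mulmx1 -AB1 mulmxA edot_mulmx nuB0 edot0r.
  exact/eqP.
apply/near_normP; exists (r / 2); first by rewrite divr_gt0.
move=> y; rewrite -[y](subrK (f x)); move: (y - f x) => v {y}.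
rewrite addrK -edot_mulmx [v + _]addrC => vr.
have vr' : `|v| < r by apply: lt_le_trans vr _; rewrite ler_pdivrMr//; lra.
split=> [Kv|vB].
  (* Shrinking v to s v stays in K; g sends the point back near x, where K is the half-space.
     Dividing by s bounds [edot (v *m B) nu] by c eps. *)
  have [c c0 Hc] := edot_bounded nu.
  apply: (@le_mul_epsilon _ _ c) => eps eps0.
  have [d d0 Hd] := diff_within_dir v gB eps0.
  case: (Knu) => nu0 /near_normP[r1 r10 Hr1].
  have w1 : 0 < `|v *m B| + eps by rewrite ltr_wpDl.
  have [s /andP[s0 s1] /andP[sd sr1]] : exists2 s, 0 < s <= 1 &
      (s < d) && (s * (`|v *m B| + eps) < r1).
    pose m := Num.min 1 (Num.min d (r1 / (`|v *m B| + eps))).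
    have m0 : 0 < m by rewrite !lt_min ltr01 d0 divr_gt0.
    have : m / 2 < m by exact: half_lt.
    rewrite {2}/m !lt_min => /and3P[H1 H2 H3]; exists (m / 2).
      by rewrite divr_gt0// ltW.
    by rewrite H2 -ltr_pdivlMr.
  have Ks : K (f x + s *: v) by apply/(Kcone v s); rewrite ?s0.
  have := Hd s; rewrite s0 sd => /(_ isT Ks).
  set y := g _; rewrite (gfK _ Kx) => ye.
  have yr : `|y - x| < r1.
    apply: le_lt_trans sr1; rewrite -(subrK (s *: (v *m B)) (y - x)).
    rewrite (le_trans (ler_normD _ _))// normrZ gtr0_norm//.
    by rewrite mulrDr addrC lerD2l mulrC.
  have /Hr1 : `|y - x| < r1 by [].
  case=> /(_ (gK _ Ks)) H _.
  have /ler_normlP[H1 _] := Hc (y - x - s *: (v *m B)).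
  rewrite edotBl edotZl in H1.
  rewrite -(ler_pM2l s0).
  have : c * `|y - x - s *: (v *m B)| <= c * (eps * s) by rewrite ler_pM2l.
  lra.
(* Since K is closed, it is enough to approximate f x + v. The image under f of x + s (v B) is f x +
   s v up to an error e s; enlarging by 1 / s gives a point of K within e of f x + v. The radius r /
   2 leaves room for e. *)
rewrite closure_id in Kcl; rewrite Kcl; apply/closure_normP => eps eps0.
pose e := Num.min eps (r / 2) / 2.
have m0 : 0 < Num.min eps (r / 2) by rewrite lt_min eps0 divr_gt0.
have e0 : 0 < e by rewrite divr_gt0.
have : e < Num.min eps (r / 2) by exact: half_lt.
rewrite lt_min => /andP[ee er].
have [d d0 Hd] := diff_within_dir (v *m B) fA e0.
have [d' d'0 Hd'] := locally_halfspace_dir (v *m B) Knu.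
have [s /andP[s0 s1] /andP[sd sd']] : exists2 s, 0 < s <= 1 &
    (s < d) && (s < d').
  pose m := Num.min 1 (Num.min d d').
  have {}m0 : 0 < m by rewrite !lt_min ltr01 d0.
  have : m / 2 < m by exact: half_lt.
  rewrite {2}/m !lt_min => /and3P[H1 H2 H3]; exists (m / 2).
    by rewrite divr_gt0// ltW.
  by rewrite H2.
have Ks : K (x + s *: (v *m B)) by apply/Hd'; rewrite ?s0.
have := Hd s; rewrite s0 sd => /(_ isT Ks).
rewrite -mulmxA BA1 mulmx1.
set k := f _ - f x => ks.
have kE : k = s *: (s^-1 *: k) by rewrite scalerA mulfV ?gt_eqF// scale1r.
have kv : `|s^-1 *: k - v| <= e.
  move: ks; rewrite {1}kE -scalerBr normrZ gtr0_norm//.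
  by rewrite mulrC ler_pM2r.
exists (f x + s^-1 *: k).
  apply/(Kcone _ s); rewrite ?s0//.
    rewrite -(subrK v (s^-1 *: k)) (le_lt_trans (ler_normD _ _))//; lra.
  by rewrite -kE /k addrC subrK; apply: fK.
by rewrite opprD addrACA subrr add0r; apply: le_lt_trans ee.
Qed.

(** Both forms are nonpositive in the same directions. The part w of mu orthogonal to nu and its
    opposite are such directions, so mu vanishes on w and w = 0; testing on - nu fixes the sign of
    c. *)
Lemma locally_halfspace_unique K q nu mu : locally_halfspace K q nu ->
  locally_halfspace K q mu -> exists2 c, 0 < c & mu = c *: nu.
Proof.
move=> Knu Kmu.
have eqv v : edot v nu <= 0 <-> edot v mu <= 0.
  have [d d0 Hd] := locally_halfspace_dir v Knu.
  have [d' d'0 Hd'] := locally_halfspace_dir v Kmu.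
  have m0 : 0 < Num.min d d' by rewrite lt_min d0.
  have := half_lt m0.
  rewrite lt_min => /andP[H1 H2].
  by rewrite -(Hd (Num.min d d' / 2)) ?H1 ?divr_gt0// Hd' ?H2 ?divr_gt0.
have [nu0 mu0] := (proj1 Knu, proj1 Kmu).
have nn := edot_gt0 nu0.
pose c := edot mu nu / edot nu nu; pose w := mu - c *: nu.
have wnu : edot w nu = 0.
  by rewrite /w edotBl edotZl /c divfK ?subrr// gt_eqF.
have wmu : edot w mu = 0.
  apply/eqP; rewrite eq_le; apply/andP; split; first by apply/eqv; rewrite wnu.
  by rewrite -oppr_le0 -edotNl; apply/eqv; rewrite edotNl wnu oppr0.
have muE : mu = c *: nu.
  apply/eqP; rewrite -subr_eq0 -/w -edot_eq0 {2}/w edotBr wmu edotZr wnu.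
  by rewrite mulr0 subrr.
exists c => //; rewrite lt_neqAle; apply/andP; split.
  by apply: contra_neq mu0 => c0; rewrite muE -c0 scale0r.
have : edot (- nu) mu <= 0 by apply/eqv; rewrite edotNl oppr_le0 ltW.
by rewrite muE edotZr edotNl mulrN oppr_le0 pmulr_lge0.
Qed.

Lemma locally_halfspaceZ K q nu c : 0 < c -> locally_halfspace K q (c *: nu) ->
  locally_halfspace K q nu.
Proof.
move=> c0 [cnu0 H]; split.
  by apply: contra_neq cnu0 => ->; rewrite scaler0.
by move: H; apply: filterS => y; rewrite edotZr pmulr_rle0.
Qed.

(** If q were strictly inside the half-space at p, K would contain a ball around q, and a short step
    from q along its own normal mu would stay in K, which is absurd. Hence q is on the hyperplane
    through p, and the half-spaces of normal nu at p and q agree. *)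
Lemma locally_halfspace_near K p nu : locally_halfspace K p nu ->
  \forall q \near p, (exists mu, locally_halfspace K q mu) ->
    edot (q - p) nu = 0 /\ locally_halfspace K q nu.
Proof.
move=> [nu0 /near_normP[r r0 H]]; apply/near_normP; exists r => // q qr.
move=> [mu Kmu]; have Kq := locally_halfspace_mem Kmu.
have [c c0 Hc] := edot_bounded nu.
have qball y : `|y - q| < r - `|q - p| -> `|y - p| < r.
  move=> yq; rewrite -(subrKA q) (le_lt_trans (ler_normD _ _))//.
  by rewrite -ltrBrDr.
have qnu : edot (q - p) nu = 0.
  apply/eqP; rewrite eq_le; apply/andP; split; first by apply/H.
  rewrite leNgt; apply/negP => qneg.
  have [d d0 Hd] := locally_halfspace_dir mu Kmu.
  have m1 : 0 < `|mu| + 1 by rewrite ltr_wpDl.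
  have cm : 0 < c * (`|mu| + 1) by rewrite mulr_gt0.
  pose m := Num.min d (Num.min ((r - `|q - p|) / (`|mu| + 1))
     (- edot (q - p) nu / (c * (`|mu| + 1)))).
  have m0 : 0 < m.
    by rewrite !lt_min d0 !divr_gt0 ?subr_gt0 ?oppr_gt0.
  have : m / 2 < m by exact: half_lt.
  rewrite {2}/m; set s := m / 2; have s0 : 0 < s by rewrite divr_gt0.
  rewrite !lt_min => /and3P[H1]; rewrite !ltr_pdivlMr// => H2 H3.
  have smu : `|s *: mu| <= s * (`|mu| + 1).
    by rewrite normrZ gtr0_norm// ler_pM2l// lerDl.
  have Ks : K (q + s *: mu).
    apply/H; first by apply: qball; rewrite [q + _]addrC addrK; lra.
    rewrite addrAC edotDl; have /ler_normlP[_] := Hc (s *: mu).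
    have : c * `|s *: mu| <= c * (s * (`|mu| + 1)) by rewrite ler_pM2l.
    lra.
  have /Hd : 0 < s < d by rewrite s0.
  case=> /(_ Ks) + _; rewrite leNgt => /negP; apply.
  exact: edot_gt0 (proj1 Kmu).
split=> //; split=> //; apply/near_normP; exists (r - `|q - p|).
  by rewrite subr_gt0.
move=> y /qball /H ->.
have -> : y - p = y - q + (q - p) by rewrite subrKA.
by rewrite [X in X <= 0 <-> _]edotDl qnu addr0.
Qed.

(** Connectedness of [0, 1]: T is relatively open by [locally_halfspace_near]. It is closed because
    a limit time has some normal mu, shared by nearby times s of T, and uniqueness of the normal at
    [gamma s] makes mu a positive multiple of nu. *)
Lemma locally_halfspace_path K (gamma : R -> 'rV[R]_n) nu :
  (forall t : R, 0 <= t <= 1 -> forall eps : R, 0 < eps ->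
     \forall s \near t, 0 <= s <= 1 -> `|gamma s - gamma t| < eps) ->
  (forall t, 0 <= t <= 1 -> exists mu, locally_halfspace K (gamma t) mu) ->
  locally_halfspace K (gamma 0) nu -> edot (gamma 1 - gamma 0) nu = 0.
Proof.
move=> gcont gK K0.
pose T := [set t : R | 0 <= t <= 1 /\
  (edot (gamma t - gamma 0) nu = 0 /\ locally_halfspace K (gamma t) nu)].
have locT (t : R) mu : 0 <= t <= 1 -> locally_halfspace K (gamma t) mu ->
    \forall s \near t, 0 <= s <= 1 ->
    edot (gamma s - gamma t) mu = 0 /\ locally_halfspace K (gamma s) mu.
  move=> t01 /locally_halfspace_near/near_normP[r r0 H].
  have := gcont t t01 r r0; apply: filterS => s Hs s01.
  by apply: H; [exact: Hs | exact: gK].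
have T0 : T 0 by split; rewrite ?lexx ?ler01// subrr edot0l.
suff : T = `[0, 1]%classic.
  move=> /predeqP/(_ 1)[_]; rewrite /= in_itv/= ler01 lexx.
  by case=> // _ [].
have itvE t : `[0, 1]%classic t <-> 0 <= t <= 1 by rewrite /= in_itv.
apply: (@segment_connected R 0 1); first by exists 0.
(* The implication makes times outside [0, 1] harmless, so that T is the trace of an open subset of
   the line. *)
- exists [set s | 0 <= s <= 1 -> T s]°; first exact: open_interior.
  apply/seteqP; split=> [t [t01 [tx Kt]]|t [/itvE t01 /interior_subset]].
    split; first exact/itvE.
    have := locT t nu t01 Kt; apply: filterS => s Hs s01.
    have [H1 H2] := Hs s01; split=> //; split=> //.
    have -> : gamma s - gamma 0 = gamma s - gamma t + (gamma t - gamma 0).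
      by rewrite subrKA.
    by rewrite edotDl H1 tx addr0.
  exact.
- exists (closure T); first exact: closed_closure.
  apply/seteqP; split=> [t Tt|t [/itvE t01 clT]].
    by split; [apply/itvE; case: Tt | exact: subset_closure].
  have [mu Kmu] := gK t t01.
  have [s [[s01 [sx Ks]] Hs]] := clT _ (locT t mu t01 Kmu).
  have [H1 H2] := Hs s01.
  have [c c0 muE] := locally_halfspace_unique Ks H2.
  split=> //; split; last by apply: (locally_halfspaceZ c0); rewrite -muE.
  have : edot (gamma s - gamma t) nu = 0.
    by move/eqP: H1; rewrite muE edotZr mulf_eq0 gt_eqF//= => /eqP.
  move: sx; rewrite !edotBl; lra.
Qed.

End halfspace.

(** * Polyhedra *)

Section polyhedra.
Context {R : realType} {n : nat}.
Implicit Types (K s : set 'rV[R]_n) (x y p q v nu : 'rV[R]_n).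

(** From the triangulation only linear inequalities are kept: near a point, membership is governed
    by the constraints that are equalities there. *)
Definition halfspaces (l m : nat) (a : 'I_l -> 'I_m -> 'rV[R]_n)
    (b : 'I_l -> 'I_m -> R) : set 'rV[R]_n :=
  [set y | exists i, forall j, edot y (a i j) <= b i j].

Lemma conv_hull_edot_le (A : set 'rV[R]_n) a b :
  (forall x, A x -> edot x a <= b) ->
  forall y, conv_hull A y -> edot y a <= b.
Proof.
move=> HA y [m [p [w [pA w0 w1 ->]]]].
rewrite edot_suml -[leRHS]mul1r -w1 mulr_suml; apply: ler_sum => i _.
by rewrite edotZl ler_wpM2l// HA.
Qed.

(* The barycentric coordinates of y with respect to p are 1 - \sum_i c i and
   c i, where y - p ord0 = c *m P. *)
Lemma simplex_halfspaces s : is_simplex n s ->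
  exists (a : 'I_n.+1 -> 'rV[R]_n) (b : 'I_n.+1 -> R),
    forall y, s y <-> forall j, edot y (a j) <= b j.
Proof.
move=> [p [sE sdim]].
pose P : 'M[R]_n := \matrix_i (p (lift ord0 i) - p ord0).
(* A rank deficiency would put the simplex in [p ord0] plus the row space of P, against its
   dimension. *)
have Pu : P \in unitmx.
  rewrite -row_free_unit /row_free eqn_leq rank_leq_row leqNgt.
  apply/negP => /(sdim (p ord0)); apply.
  rewrite sE => y [m [q [w [qp w0 w1 ->]]]] /=.
  have -> : \sum_(i < m) w i *: q i - p ord0 =
      \sum_(i < m) w i *: (q i - p ord0).
    rewrite -[X in _ - X]scale1r -w1 scaler_suml -sumrB.
    by apply: eq_bigr => i _; rewrite scalerBr.
  apply: summx_sub => i _; apply: scalemx_sub.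
  have [j _ <-] := qp i; case: (unliftP ord0 j) => [k ->|->].
    by rewrite -[_ - _](rowK (fun k => p (lift ord0 k) - p ord0)) row_sub.
  by rewrite subrr sub0mx.
pose u i : 'rV[R]_n := (col i (invmx P))^T.
have uE v i : edot v (u i) = (v *m invmx P) 0 i.
  by rewrite edotE trmxK !mxE; apply: eq_bigr => k _; rewrite mxE.
have uP k i : edot (p (lift ord0 k) - p ord0) (u i) = (k == i)%:R.
  rewrite -[_ - _](rowK (fun k => p (lift ord0 k) - p ord0)) -/P uE.
  by rewrite -row_mul mulmxV// !mxE.
(* The index [lift ord0 i] encodes that the coordinate along vertex i is nonnegative, and [ord0]
   that these coordinates sum to at most 1; b translates from [y - p ord0] to y. *)
pose a j := if unlift ord0 j is Some i then - u i else \sum_i u i.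
pose b j := edot (p ord0) (a j) + (if unlift ord0 j is Some i then 0 else 1).
have abE y j : edot y (a j) <= b j <->
    edot (y - p ord0) (a j) <= (if unlift ord0 j is Some i then 0 else 1).
  by rewrite edotBl lerBlDl.
have edot_sumu v : edot v (\sum_i u i) = \sum_i edot v (u i).
  by rewrite edotC edot_suml; apply: eq_bigr => i _; rewrite edotC.
exists a, b => y; split.
  rewrite sE => yp j; apply: conv_hull_edot_le yp => _ [k _ <-]; apply/abE.
  rewrite /a; case: (unliftP ord0 k) => [k' ->|->]; last first.
    by rewrite subrr edot0l; case: unlift.
  case: unlift => [i|]; first by rewrite edotNr uP oppr_le0 ler0n.
  rewrite edot_sumu (bigD1 k')//= uP eqxx big1 ?addr0// => i ik.
  by rewrite uP eq_sym (negbTE ik).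
move=> H; have c0 i : 0 <= edot (y - p ord0) (u i).
  by have /abE := H (lift ord0 i); rewrite /a liftK edotNr oppr_le0.
have c1 : \sum_i edot (y - p ord0) (u i) <= 1.
  by have /abE := H ord0; rewrite /a unlift_none edot_sumu.
pose w j := if unlift ord0 j is Some i then edot (y - p ord0) (u i)
  else 1 - \sum_i edot (y - p ord0) (u i).
have w0 : w ord0 = 1 - \sum_i edot (y - p ord0) (u i).
  by rewrite /w unlift_none.
have wS i : w (lift ord0 i) = edot (y - p ord0) (u i) by rewrite /w liftK.
rewrite sE; exists n.+1, p, w; split.
- by move=> i; exists i.
- by move=> j; rewrite /w; case: unlift => [i|]; rewrite ?subr_ge0.
- by rewrite big_ord_recl w0 (eq_bigr _ (fun i _ => wS i)) subrK.
- rewrite big_ord_recl w0 scalerBl scale1r -addrA scaler_suml -sumrN -big_split.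
  rewrite /= (eq_bigr (fun i => ((y - p ord0) *m invmx P) 0 i *: row i P)).
    by rewrite -mulmx_sum_row mulmxKV// addrC subrK.
  by move=> i _; rewrite wS -uE rowK scalerBr addrC.
Qed.

Lemma bounded_polyhedron_halfspaces K : bounded_polyhedron K ->
  exists (l m : nat) (a : 'I_l -> 'I_m -> 'rV[R]_n) b, K = halfspaces a b.
Proof.
move=> [l [s [ssimp -> _]]].
have [a Ha] := choice (fun i => simplex_halfspaces (ssimp i)).
have [b Hb] := choice Ha.
exists l, n.+1, a, b; apply/seteqP; split=> [y [i _ /Hb ?]|y [i H]].
  by exists i.
by exists i => //; apply/Hb.
Qed.

(** M is a natural number because it later enters a count of grid cells. *)
Lemma bounded_polyhedron_bounded K : bounded_polyhedron K ->
  exists M : nat, forall y, K y -> `|y| <= M%:R.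
Proof.
move=> [l [s [ssimp -> _]]].
have : forall i, exists M, forall y, s i y -> `|y| <= M.
  move=> i; have [p [-> _]] := ssimp i.
  exists (\sum_j `|p j|) => y [m [q [w [qp w0 w1 ->]]]].
  rewrite (le_trans (ler_norm_sum _ _ _))// -[leRHS]mul1r -w1 mulr_suml.
  apply: ler_sum => k _; rewrite normrZ ger0_norm// ler_wpM2l//.
  by have [j _ <-] := qp k; rewrite (bigD1 j)//= lerDl sumr_ge0.
move=> /choice[M HM]; exists (Num.truncn (\sum_i `|M i|)).+1 => y [i _ /HM yM].
apply: le_trans yM (le_trans _ (ltW (truncnS_gt _))).
by rewrite (le_trans (ler_norm _))// (bigD1 i)//= lerDl sumr_ge0.
Qed.

End polyhedra.

(** * Local shape of a finite union of convex polyhedra *)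

Section local_structure.
Context {R : realType} {n : nat}.
Implicit Types (K : set 'rV[R]_n) (x y p q v nu : 'rV[R]_n).

Lemma halfspace_inactive p (a : 'rV[R]_n) b : edot p a != b ->
  exists2 r, 0 < r & forall v, `|v| < r ->
    (edot (p + v) a <= b) = (edot p a <= b).
Proof.
move=> pab; have [c c0 Hc] := edot_bounded a.
have g0 : 0 < `|edot p a - b| by rewrite normr_gt0 subr_eq0.
exists (`|edot p a - b| / c); rewrite ?divr_gt0// => v.
rewrite ltr_pdivlMr// mulrC => /(le_lt_trans (Hc v)) /ltr_normlP[].
rewrite edotDl; have [pb|pb] := leP (edot p a) b.
  by rewrite ler0_norm ?subr_le0// => ? ?; apply/idP; lra.
by rewrite gtr0_norm ?subr_gt0// => ? ?; apply/negbTE; rewrite -ltNge; lra.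
Qed.

Lemma halfspaces_inactive (l m : nat) (a : 'I_l -> 'I_m -> 'rV[R]_n) b p :
  exists2 r, 0 < r & forall v, `|v| < r -> forall i j, edot p (a i j) != b i j ->
    (edot (p + v) (a i j) <= b i j) = (edot p (a i j) <= b i j).
Proof.
have /near_normP[r r0 H] : \forall v \near (0 : 'rV[R]_n), forall ij : 'I_l * 'I_m,
    edot p (a ij.1 ij.2) != b ij.1 ij.2 ->
    (edot (p + v) (a ij.1 ij.2) <= b ij.1 ij.2) =
    (edot p (a ij.1 ij.2) <= b ij.1 ij.2).
  apply: near_forall => -[i j] /=; have [pb|pb] := eqVneq (edot p (a i j)) (b i j).
    by apply/near_normP; exists 1.
  have [r r0 Hr] := halfspace_inactive pb.
  by apply/near_normP; exists r => // v; rewrite subr0 => /Hr.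
by exists r => // v vr i j; apply: (H v _ (i, j)); rewrite subr0.
Qed.

(** Near p, inactive constraints keep their truth value and active ones become homogeneous in v,
    hence insensitive to scaling. *)
Lemma halfspaces_conical (l m : nat) (a : 'I_l -> 'I_m -> 'rV[R]_n) b p :
  locally_conical (halfspaces a b) p.
Proof.
have [r r0 H] := halfspaces_inactive a b p; exists r => // v s vr /andP[s0 s1].
have sv : `|s *: v| < r.
  by apply: le_lt_trans vr; rewrite normrZ gtr0_norm// ler_piMl.
suff E i j : (edot (p + v) (a i j) <= b i j) = (edot (p + s *: v) (a i j) <= b i j).
  by split=> -[i Hi]; exists i => j; [rewrite -E | rewrite E].
have [pb|pb] := eqVneq (edot p (a i j)) (b i j); last by rewrite !H.
by rewrite !edotDl pb edotZl !gerDl pmulr_rle0.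
Qed.

(** Stated by 2 by 2 minors so that its failure provides a nonzero minor, whose two columns drive
    the covering of codimension 2 subspaces. *)
Definition collinear (u v : 'rV[R]_n) :=
  forall k l, u 0 k * v 0 l = u 0 l * v 0 k.

Lemma collinearP (u v : 'rV[R]_n) : u != 0 -> collinear u v ->
  exists c, v = c *: u.
Proof.
move=> u0 uv; have [k uk] : exists k, u 0 k != 0.
  apply/existsP; apply: contra_neqT u0; rewrite negb_exists => /forallP H.
  by apply/rowP => k; rewrite mxE; apply/eqP; have := H k; rewrite negbK.
exists (v 0 k / u 0 k); apply/rowP => l; rewrite mxE.
by apply: (mulfI uk); rewrite uv; field.
Qed.

(* If all the constraints active at p are multiples of one linear form tau,
   membership in K near p only depends on the sign of tau. *)
Lemma halfspaces_locally_halfspace (l m : nat)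
    (a : 'I_l -> 'I_m -> 'rV[R]_n) b p :
  halfspaces a b p -> ~ nbhs p (halfspaces a b) ->
  closure (halfspaces a b)° p ->
  (forall i j i' j', edot p (a i j) = b i j -> edot p (a i' j') = b i' j' ->
     collinear (a i j) (a i' j')) ->
  exists nu, locally_halfspace (halfspaces a b) p nu.
Proof.
set K := halfspaces a b => Kp nKp clp col.
have [r r0 H] := halfspaces_inactive a b p.
(* An active constraint with zero form reads 0 <= 0; if there were no other, K would be a
   neighbourhood of p. *)
have [[i0 [j0 [act0 a0]]]|noact] := pselect (exists i j,
    edot p (a i j) = b i j /\ a i j != 0); last first.
  case: nKp; suff : \forall y \near p, K y by [].
  apply/near_normP; exists r => // y yr; have [i Hi] := Kp; exists i => j.
  rewrite -[y](subrK p) addrC.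
  have [pb|pb] := eqVneq (edot p (a i j)) (b i j); last by rewrite H.
  have [a0|a0] := eqVneq (a i j) 0; first by rewrite -pb a0 !edot0r.
  by case: noact; exists i, j.
set t := a i0 j0 in act0 a0.
have sign v v' : `|v| < r -> `|v'| < r ->
    Num.sg (edot v t) = Num.sg (edot v' t) -> K (p + v) -> K (p + v').
  move=> vr vr' E [i Hi]; exists i => j; move: (Hi j).
  have [pb|pb] := eqVneq (edot p (a i j)) (b i j); last by rewrite !H.
  have [c ac] := collinearP a0 (col _ _ i j act0 pb).
  rewrite !edotDl -pb !gerDl ac !edotZr.
  by rewrite -[_ * edot v t <= 0]sgr_le0 -[_ * edot v' t <= 0]sgr_le0 !sgrM E.
have tt := edot_gt0 a0.
have [s s0 vp] := exists_small_scale t r0.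
have vm : `|- s *: t| < r by rewrite scaleNr normrN.
have sgp : Num.sg (edot (s *: t) t) = 1 by rewrite edotZl gtr0_sg// mulr_gt0.
have sgm : Num.sg (edot (- s *: t) t) = -1.
  by rewrite edotZl ltr0_sg// mulNr oppr_lt0 mulr_gt0.
have sg0 v : `|v| < r -> edot v t = 0 -> K (p + v).
  move=> vr vt; apply: (sign 0); rewrite ?normr0 ?addr0//.
  by rewrite vt edot0l.
have near_half nu : nu != 0 -> (forall v, `|v| < r -> K (p + v) <-> edot v nu <= 0) ->
    exists nu, locally_halfspace K p nu.
  move=> nu0 Hnu; exists nu; split=> //; apply/near_normP; exists r => // y yr.
  by rewrite -Hnu// addrC subrK.
(* By [sign], one test point on each side of the hyperplane decides K near p: both in K is excluded,
   exactly one gives a half-space. *)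
have [Kplus|nKplus] := pselect (K (p + s *: t)).
  have [Kminus|nKminus] := pselect (K (p + - s *: t)).
    case: nKp; suff : \forall y \near p, K y by [].
    apply/near_normP; exists r => // y yr; rewrite -[y](subrK p) addrC.
    have [vt|vt|vt] := ltgtP (edot (y - p) t) 0.
    - by apply: sign Kminus => //; rewrite sgm ltr0_sg.
    - by apply: sign Kplus => //; rewrite sgp gtr0_sg.
    - exact: sg0.
  apply: (near_half (- t)); first by rewrite oppr_eq0.
  move=> v vr; rewrite edotNr oppr_le0; split=> [Kv|].
    rewrite leNgt; apply/negP => vt; apply: nKminus.
    by apply: sign Kv => //; rewrite sgm ltr0_sg.
  rewrite le_eqVlt => /predU1P[vt|vt]; first exact: sg0.
  by apply: sign Kplus => //; rewrite sgp gtr0_sg.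
have [Kminus|nKminus] := pselect (K (p + - s *: t)).
  apply: (near_half t) => // v vr; split=> [Kv|].
    rewrite leNgt; apply/negP => vt; apply: nKplus.
    by apply: sign Kv => //; rewrite sgp gtr0_sg.
  rewrite le_eqVlt => /predU1P[vt|vt]; first exact: sg0.
  by apply: sign Kminus => //; rewrite sgm ltr0_sg.
(* With neither side in K, K would be flat near p. But p is a limit of interior points z, from which
   a short step along t stays in K. *)
have flat v : `|v| < r -> K (p + v) -> edot v t = 0.
  move=> vr Kv; have [vt|vt|//] := ltgtP (edot v t) 0.
  - by case: nKminus; apply: sign Kv => //; rewrite sgm ltr0_sg.
  - by case: nKplus; apply: sign Kv => //; rewrite sgp gtr0_sg.
have /closure_normP/(_ r r0)[z Kz zr] := clp.
have /near_normP[d d0 Hd] : \forall y \near z, K y by exact: Kz.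
have zt : edot (z - p) t = 0.
  apply: flat => //; rewrite addrC subrK; apply: (Hd z).
  by rewrite subrr normr0.
pose d1 := Num.min d (r - `|z - p|).
have d10 : 0 < d1 by rewrite lt_min d0 subr_gt0.
have [s' s'0] := exists_small_scale t d10.
rewrite lt_min => /andP[sd sr].
have := flat (z - p + s' *: t) _ _; rewrite edotDl zt edotZl add0r => E.
suff : s' * edot t t = 0 by move/eqP; rewrite mulf_eq0 !gt_eqF.
apply: E; first by rewrite (le_lt_trans (ler_normD _ _))// addrC -ltrBrDr.
by rewrite addrA [p + _]addrC subrK; apply: Hd; rewrite [z + _]addrC addrK.
Qed.

End local_structure.

(** * Hausdorff measure of subspaces of codimension 2 *)

Section hausdorff.
Context {R : realType} {n : nat}.
Implicit Types (A B : set 'rV[R]_n) (x y z v a : 'rV[R]_n).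

(* The bound m = O(N ^ (k - 1)) is multiplied by N to make sense for k = 0. *)
Definition coverable (k : nat) A := exists2 c : R, 0 < c &
  forall N : nat, (0 < N)%N -> exists (m : nat) (B : nat -> set 'rV[R]_n),
    [/\ forall y, A y -> exists2 i, (i < m)%N & B i y,
        forall i y z, B i y -> B i z -> enorm (y - z) <= c / N%:R
      & m%:R * N%:R <= c * N%:R ^+ k].

Lemma coverable0 k : coverable k set0.
Proof.
exists 1 => // N N0; exists 0%N, (fun=> set0); split=> //.
by rewrite !mul0r mul1r exprn_ge0.
Qed.

Lemma sub_coverable k A B : A `<=` B -> coverable k B -> coverable k A.
Proof.
move=> AB [c c0 H]; exists c => // N N0; have [m [C [H1 H2 H3]]] := H N N0.
by exists m, C; split=> // y /AB /H1.
Qed.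

Lemma coverableU k A B : coverable k A -> coverable k B -> coverable k (A `|` B).
Proof.
move=> [c c0 H] [c' c'0 H']; exists (c + c'); first exact: addr_gt0.
move=> N N0; have [m [C [H1 H2 H3]]] := H N N0.
have [m' [C' [H1' H2' H3']]] := H' N N0.
exists (m + m')%N, (fun i => if (i < m)%N then C i else C' (i - m)%N); split.
- move=> y [/H1[i im Ci]|/H1'[i im Ci]].
    by exists i; [rewrite ltn_addr | rewrite im].
  by exists (m + i)%N; rewrite ?ltn_add2l// ltnNge leq_addr/= addKn.
- have cN : 0 <= c / N%:R by exact: divr_ge0 (ltW c0) (ler0n _ _).
  have c'N : 0 <= c' / N%:R by exact: divr_ge0 (ltW c'0) (ler0n _ _).
  move=> i y z; rewrite mulrDl; case: ifP => _.
    by move=> Cy Cz; have := H2 _ _ _ Cy Cz; lra.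
  by move=> Cy Cz; have := H2' _ _ _ Cy Cz; lra.
- by have := lerD H3 H3'; rewrite -!mulrDl -natrD.
Qed.

Lemma coverable_bigcup k (T : finType) (A : T -> set 'rV[R]_n) :
  (forall t, coverable k (A t)) -> coverable k (\bigcup_t A t).
Proof.
move=> HA; suff H (s : seq T) : coverable k [set y | exists2 t, t \in s & A t y].
  apply: sub_coverable (H (enum T)) => y [t _ Ay].
  by exists t => //; rewrite mem_enum.
elim: s => [|t s IH].
  by apply: sub_coverable (coverable0 k) => y [].
apply: sub_coverable (coverableU (HA t) IH) => y [t']; rewrite inE.
by move=> /predU1P[->|ts] Ay; [left | right; exists t'].
Qed.

Lemma ediam_pow_ge0 k A : (0 <= ediam_pow k A)%E.
Proof.
rewrite /ediam_pow; case: asboolP => // /eqP/set0P[y Ay].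
apply: expe_ge0; apply: le_trans (ereal_sup_ubound _); last first.
  by exists (y, y).
by rewrite lee_fin sqrtr_ge0.
Qed.

Lemma ediam_le A c : (forall y z, A y -> A z -> enorm (y - z) <= c) ->
  (ediam A <= c%:E)%E.
Proof.
move=> H; apply: ge_ereal_sup => _ [[y z] [/= Ay Az] <-].
by rewrite lee_fin H.
Qed.

Lemma ediam_pow_le k A c : 0 <= c ->
  (forall y z, A y -> A z -> enorm (y - z) <= c) ->
  (ediam_pow k A <= (c ^+ k)%:E)%E.
Proof.
move=> c0 H; rewrite /ediam_pow; case: asboolP => [_|/eqP/set0P[y Ay]].
  by rewrite lee_fin exprn_ge0.
have dc := ediam_le H.
have d0 : (0 <= ediam A)%E.
  apply: le_trans (ereal_sup_ubound _); last by exists (y, y).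
  by rewrite lee_fin sqrtr_ge0.
have df : ediam A \is a fin_num by rewrite ge0_fin_numE// (le_lt_trans dc) ?ltry.
rewrite -(fineK df) -EFin_expe lee_fin lerXn2r ?nnegrE ?fine_ge0//.
by rewrite -lee_fin fineK.
Qed.

(** The cover costs at most m (c / N)^k, and m N <= c N^k bounds this by c^(k+1) / N, which tends to
    0. *)
Lemma coverable_hausdorff k A : coverable k A -> hausdorff k A = 0%E.
Proof.
move=> [c c0 H]; apply/eqP; rewrite eq_le; apply/andP; split; last first.
  apply: le_trans (ereal_sup_ubound _); last by exists 1 => //=; exact: ltr01.
  apply: le_ereal_inf_tmp => _ [C _ <-].
  by apply: nneseries_ge0 => i _ _; exact: ediam_pow_ge0.
apply: ge_ereal_sup => _ [delta /= delta0 <-].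
apply/lee_addgt0Pr => eps eps0; rewrite add0e.
(* The two summands ensure c / N <= delta, so that the cover is admissible, and a total cost of at
   most eps. *)
pose N := (Num.truncn (c / delta + c ^+ k.+1 / eps)).+1.
have HN : c / delta + c ^+ k.+1 / eps <= N%:R by exact/ltW/truncnS_gt.
have N0 : 0 < N%:R :> R by [].
have cd : 0 <= c / delta by exact: divr_ge0 (ltW c0) (ltW delta0).
have ce : 0 <= c ^+ k.+1 / eps by exact: divr_ge0 (exprn_ge0 _ (ltW c0)) (ltW eps0).
have Nd : c / N%:R <= delta.
  by rewrite ler_pdivrMr// mulrC -ler_pdivrMr//; lra.
have Ne : c ^+ k.+1 / N%:R <= eps.
  by rewrite ler_pdivrMr// mulrC -ler_pdivrMr//; lra.
have cN0 : 0 <= c / N%:R by exact: divr_ge0 (ltW c0) (ler0n _ _).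
have [m [B [AB Bd mN]]] := H N isT.
(* Padding by the empty set is free even for k = 0, by the special case in [ediam_pow]. *)
pose C i := if (i < m)%N then B i else set0.
apply: (@le_trans _ _ (\sum_(0 <= i <oo) ediam_pow k (C i))%E).
  apply: ereal_inf_lbound; exists C => //; split.
    by move=> y /AB[i im By]; exists i => //; rewrite /C im.
  move=> i; apply: ediam_le => y z; rewrite /C; case: ifP => // _ By Bz.
  exact: le_trans (Bd _ _ _ By Bz) Nd.
rewrite (nneseries_split 0 m); last by move=> i _; exact: ediam_pow_ge0.
rewrite add0n [X in (_ + X)%E]eseries0 ?adde0; last first.
  move=> i mi _; rewrite /C ltnNge mi /= /ediam_pow.
  by case: asboolP => // /(_ erefl).
apply: (@le_trans _ _ (\sum_(0 <= i < m) ((c / N%:R) ^+ k)%:E)%E).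
  apply: lee_sum => i _; apply: ediam_pow_le => // y z; rewrite /C.
  by case: ifP => // _; exact: Bd.
rewrite sumEFin lee_fin big_const_nat subn0 iter_addr_0.
apply: le_trans Ne; rewrite -[leLHS]mulr_natl expr_div_n ler_pdivlMr//.
have Nk : 0 < N%:R ^+ k :> R by rewrite exprn_gt0.
have q0 : 0 < c ^+ k / N%:R ^+ k by rewrite divr_gt0// exprn_gt0.
rewrite mulrAC mulrC; apply: le_trans (_ : c ^+ k / N%:R ^+ k * (c * N%:R ^+ k) <= _).
  by rewrite ler_pM2l.
by rewrite mulrCA divfK ?gt_eqF// -exprS.
Qed.

(** Solving for the coordinates k and l makes them Lipschitz functions of the n - 2 others. A grid
    of mesh 1 / N on those others thus cuts the set into O(N^(n-2)) pieces of diameter O(1 / N). *)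
Lemma coverable_codim2 (a a' : 'rV[R]_n) (b b' : R) (k l : 'I_n) (M : nat) :
  a 0 k * a' 0 l != a 0 l * a' 0 k ->
  coverable n.-1
    [set y | [/\ edot y a = b, edot y a' = b' & `|y| <= M%:R]].
Proof.
move=> minor; set E := [set y | _].
have kl : k != l by apply: contra_neq minor => ->.
pose D := a 0 k * a' 0 l - a 0 l * a' 0 k.
have D0 : 0 < `|D| by rewrite normr_gt0 subr_eq0.
pose P (i : 'I_n) := (i != k) && (i != l).
pose S := 1 + \sum_i (`|a 0 i| + `|a' 0 i|).
have aS i : `|a 0 i| <= S /\ `|a' 0 i| <= S.
  have : `|a 0 i| + `|a' 0 i| <= S.
    rewrite /S (bigD1 i)//= addrCA lerDl addr_ge0// sumr_ge0//.
  by have := normr_ge0 (a 0 i); have := normr_ge0 (a' 0 i); split; lra.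
have S1 : 1 <= S.
  by rewrite /S lerDl sumr_ge0// => j _; rewrite addr_ge0.
(* The 1 serves the free coordinates; the quotient bounds the two solved ones, each D-multiple being
   a sum of two terms of size at most S h S. *)
pose c1 := 1 + 2 * S ^+ 2 / `|D|.
have c11 : 1 <= c1 by rewrite /c1 lerDl divr_ge0// mulr_ge0// sqr_ge0.
(* Cramer's rule for the coordinates k and l of d. *)
have lip (d : 'rV[R]_n) (h : R) : 0 <= h -> edot d a = 0 -> edot d a' = 0 ->
    (forall i, P i -> `|d 0 i| <= h) -> `|d| <= c1 * h.
  move=> h0 da da' Hd.
  have split_sum (u : 'rV[R]_n) : edot d u =
      d 0 k * u 0 k + (d 0 l * u 0 l + \sum_(i | P i) d 0 i * u 0 i).
    by rewrite /edot (bigD1 k)//= (bigD1 l) 1?eq_sym.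
  pose rho (u : 'rV[R]_n) := \sum_(i | P i) d 0 i * u 0 i.
  have rho_le (u : 'rV[R]_n) : \sum_i `|u 0 i| <= S -> `|rho u| <= S * h.
    move=> uS; apply: le_trans (ler_norm_sum _ _ _) _.
    apply: (@le_trans _ _ (\sum_(i | P i) h * `|u 0 i|)).
      by apply: ler_sum => i Pi; rewrite normrM ler_wpM2r// Hd.
    rewrite -mulr_sumr mulrC ler_wpM2r//; apply: le_trans uS.
    by rewrite [leRHS](bigID P)/= lerDl sumr_ge0.
  have ra : `|rho a| <= S * h.
    apply: rho_le; rewrite /S big_split/= addrCA lerDl addr_ge0//.
    by rewrite sumr_ge0.
  have ra' : `|rho a'| <= S * h.
    apply: rho_le; rewrite /S big_split/= addrA lerDr addr_ge0//.
    by rewrite sumr_ge0.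
  have cramer (x u v : R) : D * x = rho a * u + rho a' * v -> `|u| <= S -> `|v| <= S ->
      `|x| <= c1 * h.
    move=> Dx uS vS; rewrite /c1 mulrDl mul1r mulrAC -[leLHS]add0r lerD//.
    rewrite ler_pdivlMr// mulrC -normrM Dx (le_trans (ler_normD _ _))//.
    have : `|rho a * u| <= S * h * S by rewrite normrM ler_pM.
    have : `|rho a' * v| <= S * h * S by rewrite normrM ler_pM.
    rewrite expr2; lra.
  have Ea := split_sum a; have Ea' := split_sum a'.
  rewrite da -/(rho a) in Ea; rewrite da' -/(rho a') in Ea'.
  apply: norm_le_coord => [|i]; first by rewrite mulr_ge0// (le_trans ler01).
  have [Pi|] := boolP (P i).
    by apply: le_trans (Hd _ Pi) _; rewrite ler_peMl.
  rewrite negb_and !negbK => /orP[] /eqP ->.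
  - apply: (cramer _ (- a' 0 l) (a 0 l)); rewrite ?normrN ?(aS l).1 ?(aS l).2//.
    have -> : rho a = - (d 0 k * a 0 k + d 0 l * a 0 l) by lra.
    have -> : rho a' = - (d 0 k * a' 0 k + d 0 l * a' 0 l) by lra.
    by rewrite /D; ring.
  - apply: (cramer _ (a' 0 k) (- a 0 k)); rewrite ?normrN ?(aS k).1 ?(aS k).2//.
    have -> : rho a = - (d 0 k * a 0 k + d 0 l * a 0 l) by lra.
    have -> : rho a' = - (d 0 k * a' 0 k + d 0 l * a' 0 l) by lra.
    by rewrite /D; ring.
(* One constant must bound both diameters and cardinality, hence a sum: the first term is for the
   Euclidean diameters, the second for the number of cells. *)
pose c := n.+1%:R * c1 + (2 * M).+1%:R ^+ n.-2 : R.
have c'0 : 0 < n.+1%:R * c1 by rewrite mulr_gt0// (lt_le_trans ltr01).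
have M0 : 0 < (2 * M).+1%:R ^+ n.-2 :> R by rewrite exprn_gt0.
exists c; first by rewrite addr_gt0.
move=> N N0; have NR0 : 0 < N%:R :> R by rewrite ltr0n.
(* Cell indices run from 0 to Q inclusive, Q being reached when a coordinate equals M. *)
pose Q := (2 * M * N)%N.
pose F := {ffun {i : 'I_n | P i} -> 'I_Q.+1}.
pose cell (y : 'rV[R]_n) i := Num.truncn ((y 0 i + M%:R) * N%:R).
pose C (f : F) := [set y | E y /\ forall i, cell y (val i) = f i].
exists #|{: F}|, (fun j => \bigcup_(f in [set f : F | enum_rank f = j :> nat]) C f).
have coord0 y i : E y -> 0 <= (y 0 i + M%:R) * N%:R.
  case=> _ _ yM; rewrite mulr_ge0//.
  by have /ler_normlP[] := le_trans (norm_coord y i) yM; lra.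
split.
- move=> y Ey; pose f : F := [ffun i => inord (cell y (val i))].
  exists (enum_rank f); first exact: ltn_ord.
  exists f => //; split=> // i; rewrite ffunE inordK// ltnS /cell.
  rewrite -(ler_nat R); apply: le_trans (_ : (y 0 (val i) + M%:R) * N%:R <= _).
    by have /andP[] := truncn_itv (coord0 y (val i) Ey).
  rewrite /Q natrM ler_pM2r// natrM.
  by case: Ey => _ _ yM; have /ler_normlP[] := le_trans (norm_coord y (val i)) yM; lra.
- move=> j y z [f /= fj [Ey yf]] [f' /= f'j [Ez zf']].
  have ff' : f = f' by apply: enum_rank_inj; apply: val_inj; rewrite /= fj.
  subst f'; apply: le_trans (enorm_le _) _.
  apply: (@le_trans _ _ (n.+1%:R * (c1 * N%:R^-1))); last first.
    by rewrite mulrA ler_pM2r ?invr_gt0// lerDl ltW.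
  rewrite ler_pM2l//; apply: lip; rewrite ?invr_ge0//.
  + by rewrite edotBl; case: Ey Ez => -> _ _ [-> _ _]; rewrite subrr.
  + by rewrite edotBl; case: Ey Ez => _ -> _ [_ -> _]; rewrite subrr.
  move=> i Pi; rewrite -[leRHS]mul1r ler_pdivlMr//.
  rewrite -[X in _ * X](ger0_norm (ltW NR0)) -normrM !mxE.
  have := yf (exist _ i Pi); have := zf' (exist _ i Pi); rewrite /cell /= => <-.
  have /andP[y1 y2] := truncn_itv (coord0 y i Ey).
  have /andP[z1 z2] := truncn_itv (coord0 z i Ez).
  move=> yz; rewrite yz in y1 y2; rewrite -natr1 in y2 z2.
  by apply/ler_normlP; split; lra.
- have cardP : #|{: {i : 'I_n | P i}}| = n.-2.
    rewrite card_sig; have := cardC (pred2 k l).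
    rewrite card2 kl /= card_ord => En.
    rewrite -[in RHS]En add2n /=; apply: eq_card => i.
    by rewrite !inE /P negb_or.
  rewrite card_ffun card_ord cardP.
  (* Two distinct columns force n >= 2, so the truncated predecessors in the exponents are
     genuine. *)
  have n2 : (1 < n)%N.
    by have := max_card (pred2 k l); rewrite card2 kl card_ord.
  have nE : n.-1 = n.-2.+1 by case: n n2 => [|[]].
  rewrite nE exprSr mulrA ler_pM2r// natrX.
  apply: (@le_trans _ _ ((2 * M).+1%:R ^+ n.-2 * N%:R ^+ n.-2)); last first.
    by rewrite ler_wpM2r ?exprn_ge0// lerDr ltW.
  rewrite -exprMn lerXn2r ?nnegrE// -natrM ler_nat /Q.
  by rewrite mulSn -[X in (X <= _)%N]add1n leq_add2r.
Qed.

End hausdorff.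

(** * Polyhedral domains *)

Section domain.
Context {R : realType} {n : nat}.
Implicit Types (Om : set 'rV[R]_n) (x y p v nu : 'rV[R]_n)
  (Phi : 'rV[R]_n -> 'rV[R]_n).

(** A Lipschitz domain has no slits: from a boundary point, a short step along e rises strictly
    above the graph and leaves the closure. Thus [Om] can be recovered from its closure. *)
Lemma interior_closure_lipschitz Om : lipschitz_domain Om ->
  (closure Om)° `<=` Om.
Proof.
move=> [oO HO] y iy; apply: contrapT => nOy.
have [|e [g [ee lg ginv /near_normP[r r0 Hr]]]] := HO y.
  by split; [exact: interior_subset iy | move=> /interior_subset].
have /near_normP[d d0 Hd] : \forall z \near y, closure Om z by exact: iy.
have m0 : 0 < Num.min r d by rewrite lt_min r0.
have [s s0] := exists_small_scale e m0.
rewrite -[s *: e](addrK y) [s *: e + y]addrC lt_min => /andP[sr /Hd Ks].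
have := chart_closure_le r0 lg Hr sr Ks.
rewrite ginv edotDl edotZl ee mulr1.
have : ~ (edot y e < g y) by move=> H; apply: nOy; apply/Hr; rewrite ?subrr ?normr0.
move/negP; rewrite -leNgt; lra.
Qed.

Lemma sub_interior_closure Om : open Om -> Om `<=` (closure Om)°.
Proof. by move=> oO; rewrite -open_subsetE//; exact: subset_closure. Qed.

Lemma locally_halfspace_interior (K : set 'rV[R]_n) x nu :
  locally_halfspace K x nu ->
  \forall y \near x, K° y <-> edot (y - x) nu < 0.
Proof.
move=> [nu0 /near_normP[r r0 H]]; apply/near_normP; exists r => // y yr.
have xball d : 0 < d -> exists2 s, 0 < s &
    `|y + s *: nu - y| < d /\ `|y + s *: nu - x| < r.
  move=> d0; have m0 : 0 < Num.min d (r - `|y - x|).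
    by rewrite lt_min d0 subr_gt0.
  have [s s0] := exists_small_scale nu m0.
  rewrite -[s *: nu](addrK y) [s *: nu + y]addrC lt_min => /andP[sd sr].
  exists s => //; split=> //.
  by rewrite -(subrKA y) (le_lt_trans (ler_normD _ _))// -ltrBrDr.
split=> [Ky|ynu].
  have /near_normP[d d0 Hd] : \forall z \near y, K z by exact: Ky.
  have [s s0 [/Hd Ks /H[/(_ Ks)]]] := xball d d0.
  rewrite addrAC [X in X <= 0 -> _]edotDl edotZl.
  have := mulr_gt0 s0 (edot_gt0 nu0); lra.
have [c c0 Hc] := edot_bounded nu.
suff : \forall z \near y, K z by [].
apply/near_normP; pose d := Num.min (r - `|y - x|) (- edot (y - x) nu / c).
exists d; first by rewrite lt_min subr_gt0 yr divr_gt0// oppr_gt0.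
move=> z; rewrite lt_min ltr_pdivlMr// => /andP[zr zc]; apply/H.
  by rewrite -(subrKA y) (le_lt_trans (ler_normD _ _))// -ltrBrDr.
have -> : z - x = z - y + (y - x) by rewrite subrKA.
rewrite edotDl; have /ler_normlP[_] := Hc (z - y); lra.
Qed.

(** Near x the boundary is flat, so the normalized nu serves as chart direction with a constant
    graph function of gradient 0. Charts describe [Om] rather than its closure, hence the passage
    through interiors. *)
Lemma locally_halfspace_normal Om x nu : lipschitz_domain Om ->
  locally_halfspace (closure Om) x nu ->
  exists mu, outward_unit_normal Om x mu /\
    forall v, edot v nu = 0 -> edot v mu = 0.
Proof.
move=> Omlip Knu; have nn := edot_gt0 (proj1 Knu).
have en : 0 < (enorm nu)^-1 by rewrite invr_gt0 sqrtr_gt0.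
pose e := (enorm nu)^-1 *: nu.
have ee : edot e e = 1.
  rewrite edotZl edotZr -(sqr_sqrtr (ltW nn)) -/(enorm nu) expr2.
  by rewrite mulrA mulrACA mulVf ?mulr1// gt_eqF// -invr_gt0.
have HOm : \forall y \near x, Om y <-> edot y e < edot x e.
  have := locally_halfspace_interior Knu; apply: filterS => y Hy.
  have -> : Om y <-> (closure Om)° y.
    split; last exact: interior_closure_lipschitz.
    by apply: sub_interior_closure; case: Omlip.
  by rewrite Hy -[edot y e < _]subr_lt0 -edotBl /e edotZr pmulr_rlt0.
exists e; split; last by move=> v vnu; rewrite /e edotZr vnu mulr0.
split.
  split; first exact: locally_halfspace_mem Knu.
  by move=> /interior_subset /(nbhs_singleton HOm); rewrite ltxx.
exists e, (cst (edot x e)), 0; split.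
- split=> //; exists 0; split=> // M M0 z _.
  by rewrite /= subrr normr0 mulr_ge0// ltW.
- exact: differentiable_cst.
- by move=> v; rewrite diff_cst edot0l.
- by rewrite subr0 /enorm ee sqrtr1 invr1 scale1r.
Qed.

(** Near t the difference quotients are within 1 of their limit [Y x], so increments from t are at
    most (|Y x| + 1) |s - t|, also at the end times and for x on the boundary. *)
Lemma isotopy_continuous Om Phi X x : isotopy Om Phi X -> closure Om x ->
  forall t : R, 0 <= t <= 1 -> forall eps : R, 0 < eps ->
  \forall s \near t, 0 <= s <= 1 -> `|X x s - X x t| < eps.
Proof.
move=> [_ _ _ _ HY] Kx t t01 eps eps0.
have [Y [_ /(_ x Kx)]] := HY t t01.
move=> /cvgrPdist_lt /(_ 1 ltr01); rewrite near_withinE near_withinE.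
move=> /near_normP[r r0 H].
have Y1 : 0 < `|Y x| + 1 by rewrite ltr_wpDl.
apply/near_normP; exists (Num.min r (eps / (`|Y x| + 1))).
  by rewrite lt_min r0 divr_gt0.
move=> s; rewrite lt_min ltr_pdivlMr// => /andP[sr se] s01.
have [->|st] := eqVneq s t; first by rewrite subrr normr0.
have st0 : s - t != 0 by rewrite subr_eq0.
have := H s sr st; rewrite /= in_itv/= => /(_ s01).
set q := _ *: _ => qY.
have -> : X x s - X x t = (s - t) *: q.
  by rewrite /q scalerA mulfV// scale1r.
rewrite normrZ; apply: le_lt_trans se.
rewrite ler_wpM2l// -(subrK (Y x) q) (le_trans (ler_normD _ _))//.
by rewrite addrC lerD2l distrC ltW.
Qed.

Lemma Diff_locally_halfspace Om Phi x nu : lipschitz_domain Om ->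
  (forall p, locally_conical (closure Om) p) -> Diff Om Phi ->
  locally_halfspace (closure Om) x nu ->
  exists mu, locally_halfspace (closure Om) (Phi x) mu.
Proof.
move=> Omlip cone [PhiC1 [PhiK Phiinj Phisurj] [Psi [PsiC1 PsiK]]] Knu.
have Kx := locally_halfspace_mem Knu.
have [A HA] := C1_diff_within Omlip PhiC1 Kx.
have [B HB] := C1_diff_within Omlip PsiC1 (PhiK x Kx).
apply: (locally_halfspace_image _ PhiK _ PsiK HA HB (cone _) Knu).
  exact: closed_closure.
(* The inverse preserves K because Phi is onto K. *)
by move=> y /Phisurj[z Kz <-]; rewrite PsiK.
Qed.

Lemma isotopy_tangent Om Phi X x nu : lipschitz_domain Om ->
  (forall p, locally_conical (closure Om) p) -> isotopy Om Phi X ->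
  locally_halfspace (closure Om) x nu -> edot (Phi x - x) nu = 0.
Proof.
move=> Omlip cone iso Knu; have Kx := locally_halfspace_mem Knu.
have [_ X0 X1 XD _] := iso.
rewrite -(X1 x Kx) -{2}(X0 x Kx).
apply: (@locally_halfspace_path _ _ (closure Om) (X x)); last by rewrite X0.
  exact: isotopy_continuous iso Kx.
move=> t /XD Dt; exact: (Diff_locally_halfspace Omlip cone Dt Knu).
Qed.

Lemma C1_closure_subid Om Phi : C1_closure Om Phi ->
  C1_closure Om (fun x => Phi x - x).
Proof.
move=> [hc hd hD].
have hid : {within closure Om, continuous (fun y : 'rV[R]_n => y)}.
  by apply: continuous_subspaceT => y; exact: cvg_id.
split.
- by move=> y; apply: continuousB; [exact: hc | exact: hid].
- by move=> y Oy; apply: differentiableB => //; exact: hd.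
move=> v; have [D [Dc HD]] := hD v; exists (fun y => D y - v); split.
  move=> y; apply: continuousB; first exact: Dc.
  by apply: continuous_subspaceT; exact: cst_continuous.
move=> y Oy; have di : is_diff y (id : 'rV[R]_n -> 'rV[R]_n) id by exact: is_diff_id.
have -> : (fun z => Phi z - z) = Phi - id by [].
rewrite diffB//; last exact: hd.
change ('d Phi y v - 'd (id : 'rV[R]_n -> 'rV[R]_n) y v = D y - v).
by congr (_ - _); [exact: HD | case: di => _ ->].
Qed.

(* Points where two independent constraints are active lie on finitely many
   affine subspaces of codimension 2. *)
Lemma polyhedral_boundary_coverable Om : polyhedral_domain Om ->
  coverable n.-1
    [set x | boundary Om x /\ ~ exists nu, locally_halfspace (closure Om) x nu].
Proof.
move=> [Omlip _ poly].
have [l [m [a [b KE]]]] := bounded_polyhedron_halfspaces poly.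
have [M HM] := bounded_polyhedron_bounded poly.
pose T := (('I_l * 'I_m) * ('I_l * 'I_m) * ('I_n * 'I_n))%type.
pose aa (t : T) := a t.1.1.1 t.1.1.2; pose aa' (t : T) := a t.1.2.1 t.1.2.2.
pose minor (t : T) := aa t 0 t.2.1 * aa' t 0 t.2.2 != aa t 0 t.2.2 * aa' t 0 t.2.1.
(* Including [minor t] empties E t when the chosen minor vanishes, so the finite union may range
   over all indices. *)
pose E (t : T) : set 'rV[R]_n := [set y | minor t /\
  [/\ edot y (aa t) = b t.1.1.1 t.1.1.2, edot y (aa' t) = b t.1.2.1 t.1.2.2
   & `|y| <= M%:R]].
have EC t : coverable n.-1 (E t).
  have [mt|nmt] := boolP (minor t); last first.
    by apply: sub_coverable (coverable0 _) => y []; rewrite (negbTE nmt).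
  apply: sub_coverable (coverable_codim2 _ _ M mt) => y [_ Ey]; exact: Ey.
apply: sub_coverable (coverable_bigcup EC) => x [[Kx nOx] nsmooth].
apply: contrapT => nE; apply: nsmooth; rewrite KE.
apply: halfspaces_locally_halfspace; rewrite -?KE//.
- move=> /(interior_closure_lipschitz Omlip) Ox; apply: nOx.
  by rewrite ((interior_id Om).1 (proj1 Omlip)).
- move=> B /Kx[z [Oz Bz]]; exists z; split=> //.
  by apply: sub_interior_closure Oz; case: Omlip.
- move=> i j i' j' pij pij' k k'; apply/eqP; apply: contrapT => /negP mt.
  apply: nE; exists ((i, j), (i', j'), (k, k')) => //; split=> //; split=> //.
  exact: HM.
Qed.

End domain.

Theorem proposition3p9 (R : realType) (n : nat) (Om : set 'rV[R]_n)
    (Phi : 'rV[R]_n -> 'rV[R]_n) :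
  polyhedral_domain Om -> Diff0 Om Phi ->
  exists phi : 'rV[R]_n -> 'rV[R]_n,
    U0 Om phi /\ forall x, closure Om x -> Phi x = x + phi x.
Proof.
move=> Ompoly [[PhiC1 _ _] [X iso]]; have [Omlip _ poly] := Ompoly.
exists (fun x => Phi x - x); split; last by move=> x _; rewrite addrC subrK.
split; first exact: C1_closure_subid.
(* It is enough that the boundary condition holds at every regular point, the other boundary points
   being coverable. *)
apply: coverable_hausdorff; apply: sub_coverable (polyhedral_boundary_coverable Ompoly).
move=> x [bx nnormal]; split=> // -[nu Knu]; apply: nnormal.
have [mu [Hmu nmu]] := locally_halfspace_normal Omlip Knu.
exists mu; split=> //; apply: nmu; apply: isotopy_tangent iso Knu => // p.
by have [l [m [a [b ->]]]] := bounded_polyhedron_halfspaces poly;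
  exact: halfspaces_conical.
Qed.
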